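(* Let $(\mathcal{X}_1,\mathcal{Y}_1)$ be a continuous biframe Bessel mapping in $\mathcal{H}_1$ with respect to $(\Omega_1,\mu_1)$ and $(\mathcal{X}_2,\mathcal{Y}_2)$ a continuous biframe Bessel mapping in $\mathcal{H}_2$ with respect to $(\Omega_2,\mu_2)$. Suppose $m_1:\Omega_1\to\mathbb{C}$ and $m_2:\Omega_2\to\mathbb{C}$ are measurable, and define $$\mathcal{X}(\omega_1,\omega_2)=\mathcal{X}_1(\omega_1)\otimes_{\mathcal{A}}\mathcal{X}_2(\omega_2),\qquad \mathcal{Y}(\omega_1,\omega_2)=\mathcal{Y}_1(\omega_1)\otimes_{\mathcal{A}}\mathcal{Y}_2(\omega_2).$$ Then $(\mathcal{X},\mathcal{Y})$ is a continuous biframe Bessel mapping on $\mathcal{H}_1\otimes_{\mathcal{A}}\mathcal{H}_2$ with respect to $(\Omega_1\times\Omega_2,\mu_1\otimes\mu_2)$. If $m(\omega_1,\omega_2)=m_1(\omega_1)m_2(\omega_2)$, then $$\mathcal{M}_{m,\mathcal{X},\mathcal{Y}}=\mathcal{M}_{m_1,\mathcal{X}_1,\mathcal{Y}_1}\otimes_{\mathcal{A}}\mathcal{M}_{m_2,\mathcal{X}_2,\mathcal{Y}_2}.$$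
   Context: $\mathcal{A}$ is a unital $C^*$-algebra; $\mathcal{H}_1,\mathcal{H}_2$ are Hilbert $\mathcal{A}$-modules (left modules, inner product $\mathcal{A}$-linear in the first variable); $(\Omega_1,\mu_1),(\Omega_2,\mu_2)$ are measure spaces with positive measures. Inequalities between elements of $\mathcal{A}$ refer to the usual order of self-adjoint elements; integrals are Banach-space-valued (Bochner type) integrals. Tensor product: $\mathcal{H}_1\otimes_{\mathcal{A}}\mathcal{H}_2$ denotes the Hilbert $\mathcal{A}$-module obtained by completing the span of the pure tensors $f\otimes g$, with $\mathcal{A}$-valued inner product satisfying $\langle f_1\otimes g_1,f_2\otimes g_2\rangle_{\mathcal{A}}=\langle f_1,f_2\rangle_{\mathcal{H}_1}\langle g_1,g_2\rangle_{\mathcal{H}_2}$ (it is part of the setting that this defines a Hilbert $\mathcal{A}$-module). For operators $S,T$ on $\mathcal{H}_1,\mathcal{H}_2$, $S\otimes_{\mathcal{A}}T$ is determined by $(S\otimes_{\mathcal{A}}T)(f\otimes g)=Sf\otimes Tg$. Continuous biframe Bessel mapping for a Hilbert $\mathcal{A}$-module $\mathcal{H}$ with respect to $(\Omega,\mu)$: a pair of mappings $\mathcal{X},\mathcal{Y}:\Omega\to\mathcal{H}$ such that for all $f\in\mathcal{H}$ the functions $\omega\mapsto\langle f,\mathcal{X}(\omega)\rangle_{\mathcal{A}}$, $\omega\mapsto\langle f,\mathcal{Y}(\omega)\rangle_{\mathcal{A}}$ are measurable and there is $B>0$ with $\int_\Omega\langle f,\mathcal{X}(\omega)\rangle_{\mathcal{A}}\langle\mathcal{Y}(\omega),f\rangle_{\mathcal{A}}\,d\mu\le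 B\langle f,f\rangle_{\mathcal{A}}$ for all $f\in\mathcal{H}$. For $\mathcal{H}=\mathcal{H}_1\otimes_{\mathcal{A}}\mathcal{H}_2$ the conditions are required for all pure tensors $f\otimes g$. Bessel multiplier: for a measurable $m:\Omega\to\mathbb{C}$, $\mathcal{M}_{m,\mathcal{X},\mathcal{Y}}$ is the operator $f\mapsto\int_\Omega m(\omega)\langle f,\mathcal{X}(\omega)\rangle_{\mathcal{A}}\mathcal{Y}(\omega)\,d\mu(\omega)$; on $\mathcal{H}_1\otimes_{\mathcal{A}}\mathcal{H}_2$ it is defined by this formula on pure tensors $f\otimes g$ and extended by linearity and continuity. In this setting the multipliers involved are taken to be well-defined operators. *)

(* Defs.v *)
From HB Require Import structures.
From mathcomp Require Import all_boot all_order all_algebra.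
From mathcomp Require Import complex.
From mathcomp Require Import all_classical all_reals all_analysis.

Set Implicit Arguments.
Unset Strict Implicit.
Unset Printing Implicit Defensive.

Import Order.TTheory GRing.Theory Num.Theory.
Import numFieldNormedType.Exports.

Local Open Scope classical_set_scope.
Local Open Scope ring_scope.
Local Open Scope complex_scope.

(* The complex numbers are R[i] for R : realType; norms of R[i]-normed modules
   take values in R[i] and are real and nonnegative there. *)

(* The product is a field of the mixin rather than the ring product of an
   algType: Hierarchy Builder rejects a join of completeNormedModType and
   algType declared after numDomainType. *)
HB.mixin Record isCStarAlgebra (R : realType) A of CompleteNormedModule R[i] A := {
  cmul : A -> A -> A;
  cone : A;
  cstar : A -> A;
  cmulA : forall a b c, cmul a (cmul b c) = cmul (cmul a b) c;
  cmul1l : forall a, cmul cone a = a;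
  cmul1r : forall a, cmul a cone = a;
  cmulDl : forall a b c, cmul (a + b) c = cmul a c + cmul b c;
  cmulDr : forall a b c, cmul a (b + c) = cmul a b + cmul a c;
  cmulZl : forall (k : R[i]) a b, cmul (k *: a) b = k *: cmul a b;
  cmulZr : forall (k : R[i]) a b, cmul a (k *: b) = k *: cmul a b;
  cstarK : forall a, cstar (cstar a) = a;
  cstarD : forall a b, cstar (a + b) = cstar a + cstar b;
  cstarZ : forall (k : R[i]) a, cstar (k *: a) = k^* *: cstar a;
  cstarM : forall a b, cstar (cmul a b) = cmul (cstar b) (cstar a);
  ler_norm_cmul : forall a b : A, `|cmul a b| <= `|a| * `|b|;
  norm_cstar_mul : forall a : A, `|cmul (cstar a) a| = `|a| ^+ 2
}.

#[short(type="cstarAlgebraType")]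
HB.structure Definition CStarAlgebra (R : realType) :=
  { A of CompleteNormedModule R[i] A & isCStarAlgebra R A }.

Notation "a ⋅ b" := (cmul a b) (at level 40, left associativity) : ring_scope.

Section CStarOrder.
Context {R : realType} {A : cstarAlgebraType R}.
Implicit Types a b : A.

Definition cinvertible a : Prop := exists b, a ⋅ b = cone /\ b ⋅ a = cone.

Definition spectrum a : set R[i] := [set l | ~ cinvertible (l *: cone - a)].

(* In the order of R[i], 0 <= l means that l is real and nonnegative. *)
Definition cpositive a : Prop :=
  cstar a = a /\ forall l, spectrum a l -> 0 <= l.

Definition cle a b : Prop :=
  [/\ cstar a = a, cstar b = b & cpositive (b - a)].

End CStarOrder.

(* A Hilbert A-module is complete for the norm |x| = |<x, x>|^(1/2); the field
   normr_ip identifies it with the norm of the underlying complex Banach space,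
   and makes the inner product definite. *)
HB.mixin Record isHilbertModule (R : realType) (A : cstarAlgebraType R) H
    of CompleteNormedModule R[i] H := {
  act : A -> H -> H;
  ip : H -> H -> A;
  act1 : forall x, act cone x = x;
  actA : forall a b x, act a (act b x) = act (a ⋅ b) x;
  actDl : forall a b x, act (a + b) x = act a x + act b x;
  actDr : forall a x y, act a (x + y) = act a x + act a y;
  actZ : forall (k : R[i]) a x, act (k *: a) x = k *: act a x;
  ipDl : forall x y z, ip (x + y) z = ip x z + ip y z;
  ip_act : forall a x y, ip (act a x) y = a ⋅ ip x y;
  cstar_ip : forall x y, cstar (ip x y) = ip y x;
  ip_ge0 : forall x, cpositive (ip x x);
  normr_ip : forall x : H, `|x| ^+ 2 = `|ip x x|
}.

#[short(type="hilbertModuleType")]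
HB.structure Definition HilbertModule (R : realType) (A : cstarAlgebraType R) :=
  { H of CompleteNormedModule R[i] H & isHilbertModule R A H }.

Section Bochner.
Context {d : measure_display} {T : measurableType d} {R : realType}.
Context {V : completeNormedModType R[i]}.
Implicit Types (s f : T -> V) (mu : {measure set T -> \bar R}).

Definition simple_fun s : Prop :=
  finite_set (range s) /\ forall v, measurable (s @^-1` [set v]).

(* Equivalent to Borel measurability when V is separable. *)
Definition strongly_measurable f : Prop :=
  exists s : nat -> T -> V, (forall n, simple_fun (s n)) /\
    (forall x, s n x @[n --> \oo] --> f x).

Definition integrable_simple mu s : Prop :=
  simple_fun s /\ forall v, v != 0 -> (mu (s @^-1` [set v]) < +oo)%E.

Definition simple_integral mu s : V :=
  \sum_(v \in range s) (fine (mu (s @^-1` [set v])))%:C *: v.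

Definition is_bochner_integral mu f (I : V) : Prop :=
  strongly_measurable f /\
  exists s : nat -> T -> V,
    [/\ forall n, integrable_simple mu (s n),
        (\int[mu]_x (complex.Re `|f x - s n x|)%:E)%E @[n --> \oo] --> 0%E
      & simple_integral mu (s n) @[n --> \oo] --> I].

End Bochner.

Definition complex_measurable d (T : measurableType d) (R : realType)
    (m : T -> R[i]) : Prop :=
  measurable_fun setT (fun x => complex.Re (m x)) /\
  measurable_fun setT (fun x => complex.Im (m x)).

Definition is_product_measure d1 d2 (T1 : measurableType d1)
    (T2 : measurableType d2) (R : realType)
    (mu1 : {measure set T1 -> \bar R}) (mu2 : {measure set T2 -> \bar R})
    (mu : {measure set (T1 * T2) -> \bar R}) : Prop :=
  forall A1 A2, measurable A1 -> measurable A2 ->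
    mu (A1 `*` A2) = (mu1 A1 * mu2 A2)%E.

Section Biframes.
Context {d : measure_display} {T : measurableType d} {R : realType}.
Context {A : cstarAlgebraType R} {H : hilbertModuleType A}.
Implicit Types (D : set H) (mu : {measure set T -> \bar R}) (X Y : T -> H).

(* D is the set of vectors on which the conditions are required. *)
Definition biframe_bessel_on D mu X Y : Prop :=
  (forall f, D f -> strongly_measurable (fun w => ip f (X w)) /\
                    strongly_measurable (fun w => ip f (Y w))) /\
  exists B : R, 0 < B /\
    forall f, D f -> exists I : A,
      is_bochner_integral mu (fun w => ip f (X w) ⋅ ip (Y w) f) I /\
      cle I (B%:C *: ip f f).

Definition biframe_bessel mu X Y : Prop := biframe_bessel_on setT mu X Y.

Definition is_multiplier_on D mu (m : T -> R[i]) X Y (M : H -> H) : Prop :=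
  [/\ linear M, continuous M &
      forall f, D f ->
        is_bochner_integral mu (fun w => m w *: act (ip f (X w)) (Y w)) (M f)].

Definition is_multiplier mu (m : T -> R[i]) X Y (M : H -> H) : Prop :=
  is_multiplier_on setT mu m X Y M.

End Biframes.

Section Tensor.
Context {R : realType} {A : cstarAlgebraType R} {H1 H2 H : hilbertModuleType A}.
Implicit Type tens : H1 -> H2 -> H.

(* Bilinearity of tens follows from the inner product formula. *)
Definition is_tensor_product tens : Prop :=
  (forall f1 f2 g1 g2,
     ip (tens f1 g1) (tens f2 g2) = ip f1 f2 ⋅ ip g1 g2) /\
  closure [set x | exists (n : nat) (c : 'I_n -> R[i]) (f : 'I_n -> H1)
      (g : 'I_n -> H2), x = \sum_(i < n) c i *: tens (f i) (g i)] = setT.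

Definition pure_tensors tens : set H := [set x | exists f g, x = tens f g].

Definition is_tensor_operator tens (S : H1 -> H1) (T : H2 -> H2) (U : H -> H) :
    Prop :=
  [/\ linear U, continuous U & forall f g, U (tens f g) = tens (S f) (T g)].

End Tensor.

(* Main.v *)
Require Import Defs.
From HB Require Import structures.
From mathcomp Require Import all_boot all_order all_algebra.
From mathcomp Require Import complex finmap.
From mathcomp Require Import all_classical all_reals all_analysis.
From mathcomp Require Import measurable_realfun ring lra zify.

Set Implicit Arguments.
Unset Strict Implicit.
Unset Printing Implicit Defensive.

Import Order.TTheory GRing.Theory Num.Theory.
Import numFieldNormedType.Exports.
Import HBNNSimple.

Local Open Scope classical_set_scope.
Local Open Scope ring_scope.
Local Open Scope complex_scope.

(** Taking adjoints in [<f1 (x) g1, f2 (x) g2> = <f1, f2> <g1, g2>] shows that the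
    inner products of [H1] commute with those of [H2] ([ip_comm]). Both assertions
    then concern integrals of the form [phi (f1 w1) (f2 w2)] with [phi] bilinear:
    the integrand of the product biframe at [f (x) g] is the product in [A] of the
    integrands at [f] and at [g], and the integrand of its multiplier is the tensor
    product of the integrands of [M1] and [M2]. For contractive bilinear [phi] such
    an integral is [phi I1 I2], where [I1] and [I2] are the integrals of the
    factors ([bochner_bilin]): this is immediate for simple functions, and the
    error terms are integrals of products of nonnegative functions, which factor
    by monotone convergence ([integral_prod]). With [phi] the tensor product
    ([tens_bilinear]) this computes the integral defining the multiplier at
    [f (x) g] as [M1 f (x) M2 g], and uniqueness of the Bochner integral turns this
    into the stated equivalence.

    With [phi] the product of [A], the integral in the Bessel inequality is
    [I1 I2], to be compared with [<f, f> <g, g>]. The hypotheses bound [I1] and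
    [I2] from above only, but bounds from below follow. By Baire's argument
    ([locally_bounded]) and Fatou's lemma there is [C] with [|I f| <= C |f| ^ 2]
    for all [f] ([rnorm_form_bound]). Replacing [f] by [a f] gives
    [|a (I f) a^*| <= C |a <f, f> a^*|] for every [a] in [A]; with [a] the inverse
    square root of [<f, f> + e] this becomes [- C <f, f> <= I f <= C <f, f>]
    ([cpositive_of_form], [form_two_sided]). Writing [p], [q] for [<f, f>], [<g, g>],
    the identity
      [2 (C ^ 2 p q - I1 I2) = (C p - I1) (C q + I2) + (C p + I1) (C q - I2)]
    expresses what is wanted as a sum of products of commuting positive elements.

    Positivity is defined by the spectrum, so the order of [A] is developed from
    the Neumann series. The central fact is that a self-adjoint element attains
    its norm on its spectrum ([norm_in_spectrum]); it makes sums, products of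
    commuting elements and conjugates by self-adjoint invertible elements of
    positive elements positive. *)

(** * Real-valued norms of complex Banach spaces *)

Lemma Re_norm_real (R : realType) (t : R) : complex.Re `|t%:C| = `|t|.
Proof. by rewrite normc_def /= expr0n addr0 sqrtr_sqr. Qed.

Section RealNorm.
Context {R : realType} {V : normedModType R[i]}.
Implicit Types x y z : V.

(** Norms over [R[i]] are elements of [R[i]]; all estimates are made on this
    real part. *)
Definition rnorm x : R := complex.Re `|x|.

Lemma rnormE x : `|x| = (rnorm x)%:C.
Proof. by rewrite RRe_real// ger0_real. Qed.

Lemma rnorm_ge0 x : 0 <= rnorm x.
Proof. by rewrite -ler0c -rnormE. Qed.

Lemma rnormN x : rnorm (- x) = rnorm x.
Proof. by rewrite /rnorm normrN. Qed.

Lemma rnormD x y : rnorm (x + y) <= rnorm x + rnorm y.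
Proof. by rewrite -lecR rmorphD/= -!rnormE ler_normD. Qed.

Lemma rnormBC x y : rnorm (x - y) = rnorm (y - x).
Proof. by rewrite -rnormN opprB. Qed.

Lemma rnormB x y z : rnorm (x - z) <= rnorm (x - y) + rnorm (y - z).
Proof. by rewrite -[x - z](subrKA y) rnormD. Qed.

Lemma rnorm0 : rnorm (0 : V) = 0.
Proof. by rewrite /rnorm normr0. Qed.

Lemma rnorm_eq0 x : (rnorm x == 0) = (x == 0).
Proof. by rewrite -[RHS]normr_eq0 rnormE -(inj_eq (@complexI _)). Qed.

Lemma rnorm_le0 x : (rnorm x <= 0) = (x == 0).
Proof. by rewrite -rnorm_eq0 eq_le rnorm_ge0 andbT. Qed.

Lemma rnormZ (k : R[i]) x : rnorm (k *: x) = complex.Re `|k| * rnorm x.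
Proof.
by apply: complexI; rewrite rmorphM/= -!rnormE normrZ.
Qed.

Lemma rnormZr (t : R) x : rnorm (t%:C *: x) = `|t| * rnorm x.
Proof.
by rewrite rnormZ; congr (_ * _); rewrite normc_def/= expr0n/= addr0 sqrtr_sqr.
Qed.

Lemma rnorm_sum (I : Type) (r : seq I) (P : pred I) (F : I -> V) :
  rnorm (\sum_(i <- r | P i) F i) <= \sum_(i <- r | P i) rnorm (F i).
Proof.
elim/big_rec2: _ => [|i t s _ le_ts]; first by rewrite rnorm0.
by rewrite (le_trans (rnormD _ _))// lerD2l.
Qed.

Lemma rnorm_ler_dist x y : `|rnorm x - rnorm y| <= rnorm (x - y).
Proof.
rewrite ler_norml; apply/andP; split.
  by have := rnormD (y - x) x; rewrite subrK (rnormBC y); lra.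
by have := rnormD (x - y) y; rewrite subrK; lra.
Qed.

Lemma cvg_rnorm (T : Type) (F : set_system T) {FF : Filter F} (u : T -> V) (l : V) :
  u @ F --> l <-> rnorm (u t - l) @[t --> F] --> (0 : R).
Proof.
split=> [/cvgr_distC_lt ul|].
  apply/cvgr0Pnorm_lt => e e0.
  have : 0 < e%:C by rewrite ltcR.
  move=> /ul; apply: filterS => t.
  by rewrite rnormE ltcR (ger0_norm (rnorm_ge0 _)).
move=> /cvgr0Pnorm_lt ul; apply/cvgrPdistC_lt => e e0.
have eE : e = (complex.Re e)%:C by rewrite RRe_real// gtr0_real.
have : 0 < complex.Re e by rewrite -ltcR -eE.
move=> /ul; apply: filterS => t.
by rewrite rnormE {2}eE ltcR (ger0_norm (rnorm_ge0 _)).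
Qed.

Lemma rnorm_squeeze (T : Type) (F : set_system T) {FF : Filter F} (u : T -> V) (l : V)
    (e : T -> R) :
  (forall t, rnorm (u t - l) <= e t) -> e @ F --> (0 : R) -> u @ F --> l.
Proof.
move=> ue e0; apply/cvg_rnorm.
apply: (squeeze_cvgr _ (cvg_cst 0) e0).
by apply: nearW => t; rewrite rnorm_ge0 ue.
Qed.

Lemma cvg_rnormr (u : nat -> V) (l : V) :
  u @ \oo --> l -> rnorm (u n) @[n --> \oo] --> rnorm l.
Proof.
move=> /cvg_rnorm ul; rewrite -[rnorm l]addr0; apply/cvgrPdist_le => e e0.
have /cvgr0Pnorm_le/(_ _ e0) := ul; apply: filterS => n.
rewrite addr0 (ger0_norm (rnorm_ge0 _)); apply: le_trans.
by rewrite distrC rnorm_ler_dist.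
Qed.

Lemma rnorm_lim_le (u : nat -> V) (l v : V) (c : R) :
  u @ \oo --> l -> (\forall n \near \oo, rnorm (u n - v) <= c) ->
  rnorm (l - v) <= c.
Proof.
move=> ul uc.
have h : rnorm (u n - v) @[n --> \oo] --> rnorm (l - v).
  by apply: cvg_rnormr; apply: cvgB => //; exact: cvg_cst.
by rewrite -(cvg_lim _ h)//; apply: limr_le => //; apply/cvg_ex; exists (rnorm (l - v)).
Qed.

Lemma cvg_unique_seq (u : nat -> V) (a b : V) :
  u @ \oo --> a -> u @ \oo --> b -> a = b.
Proof. by move=> ua ub; apply: (cvg_unique _ ua ub). Qed.

End RealNorm.

Section RealNormComplete.
Context {R : realType} {V : completeNormedModType R[i]}.

(** Cauchy sequences with geometrically decreasing steps: the form in which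
    completeness is used for the Neumann series, for the iteration giving square
    roots and for nested balls. *)
Lemma geometric_steps_cvg (u : nat -> V) (C r : R) : 0 <= r < 1 ->
  (forall n, rnorm (u n.+1 - u n) <= C * r ^+ n) ->
  exists l, u @ \oo --> l /\
    forall n, rnorm (l - u n) <= C * r ^+ n / (1 - r).
Proof.
move=> /andP[r0 r1] step.
have C0 : 0 <= C by have := step 0%N; rewrite expr0 mulr1; apply: le_trans; exact: rnorm_ge0.
have r1' : 0 < 1 - r by rewrite subr_gt0.
have far n k : rnorm (u (n + k)%N - u n) <= C * r ^+ n / (1 - r).
  suff : rnorm (u (n + k)%N - u n) <= C * r ^+ n * (1 - r ^+ k) / (1 - r).
    move=> /le_trans; apply; rewrite ler_pM2r ?invr_gt0//.
    rewrite ler_piMr ?mulr_ge0 ?exprn_ge0//.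
    by rewrite lerBlDr lerDl exprn_ge0.
  elim: k => [|k ih]; first by rewrite addn0 subrr rnorm0 expr0 subrr mulr0 mul0r.
  rewrite addnS (le_trans (rnormB _ (u (n + k)%N) _))//.
  apply: (le_trans (lerD (step _) ih)).
  rewrite le_eqVlt; apply/orP; left; apply/eqP.
  rewrite exprD exprS; field.
  by rewrite gt_eqF.
have tail0 : C * r ^+ n / (1 - r) @[n --> \oo] --> (0 : R).
  rewrite -[0](mul0r (1 - r)^-1); apply: cvgMl.
  rewrite -[X in _ --> X](mulr0 C); apply: cvgMr.
  by apply: cvg_expr; rewrite ger0_norm.
have ucvg : cvg (u @ \oo).
  apply/cauchy_cvgP/cauchyP => e e0.
  have eE : e = (complex.Re e)%:C by rewrite RRe_real// gtr0_real.
  have e0' : 0 < complex.Re e by rewrite -ltcR -eE.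
  have /cvgr0Pnorm_lt/(_ _ e0')[N _ hN] := tail0.
  exists (u N); exists N => //= n Nn.
  rewrite -ball_normE/= rnormE eE ltcR rnormBC -(subnKC Nn).
  apply: (le_lt_trans (far _ _)).
  by have := hN N (leqnn N); apply: le_lt_trans; exact: ler_norm.
have {}ucvg : u @ \oo --> lim (u @ \oo) by exact: ucvg.
exists (lim (u @ \oo)); split=> // n.
apply: (rnorm_lim_le ucvg).
by exists n => //= k nk; rewrite -(subnKC nk).
Qed.

End RealNormComplete.

(** * C*-algebras: Neumann series and spectrum *)

Lemma conjCE (R : realType) (k : R[i]) : Num.conj k = conjc k.
Proof. by []. Qed.

Section CStarBasics.
Context {R : realType} {A : cstarAlgebraType R}.
Implicit Types (a b c x : A) (k l : R[i]) (t : R).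

Lemma cmul0l a : 0 ⋅ a = 0.
Proof. by apply: (addIr (0 ⋅ a)); rewrite -cmulDl !add0r. Qed.

Lemma cmul0r a : a ⋅ 0 = 0.
Proof. by apply: (addIr (a ⋅ 0)); rewrite -cmulDr !add0r. Qed.

Lemma cmulNl a b : (- a) ⋅ b = - (a ⋅ b).
Proof. by apply: (addIr (a ⋅ b)); rewrite -cmulDl !addNr cmul0l. Qed.

Lemma cmulNr a b : a ⋅ (- b) = - (a ⋅ b).
Proof. by apply: (addIr (a ⋅ b)); rewrite -cmulDr !addNr cmul0r. Qed.

Lemma cmulBl a b c : (a - b) ⋅ c = a ⋅ c - b ⋅ c.
Proof. by rewrite cmulDl cmulNl. Qed.

Lemma cmulBr a b c : a ⋅ (b - c) = a ⋅ b - a ⋅ c.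
Proof. by rewrite cmulDr cmulNr. Qed.

Lemma cstar0 : cstar (0 : A) = 0.
Proof. by apply: (addIr (cstar 0)); rewrite -cstarD !add0r. Qed.

Lemma cstarN a : cstar (- a) = - cstar a.
Proof. by apply: (addIr (cstar a)); rewrite -cstarD !addNr cstar0. Qed.

Lemma cstarB a b : cstar (a - b) = cstar a - cstar b.
Proof. by rewrite cstarD cstarN. Qed.

Lemma cstar1 : cstar (cone : A) = cone.
Proof. by rewrite -[LHS]cmul1r -{2}(cstarK cone) -cstarM cmul1r cstarK. Qed.

Lemma cstarZr t a : cstar (t%:C *: a) = t%:C *: cstar a.
Proof. by rewrite cstarZ conjCE conjc_real. Qed.

Lemma rnorm_cmul a b : rnorm (a ⋅ b) <= rnorm a * rnorm b.
Proof. by rewrite -lecR rmorphM/= -!rnormE ler_norm_cmul. Qed.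

Lemma rnorm_cstar_mul a : rnorm (cstar a ⋅ a) = rnorm a ^+ 2.
Proof. by apply: complexI; rewrite rmorphXn/= -!rnormE norm_cstar_mul. Qed.

(** [|a| ^ 2 = |a^* a| <= |a^*| |a|] gives one inequality, for every [a]. *)
Lemma rnorm_cstar a : rnorm (cstar a) = rnorm a.
Proof.
have le_star x : rnorm x <= rnorm (cstar x).
  have [->|x0] := eqVneq x 0; first by rewrite rnorm0 rnorm_ge0.
  have xgt0 : 0 < rnorm x by rewrite lt_neqAle eq_sym rnorm_eq0 x0 rnorm_ge0.
  by rewrite -(ler_pM2r xgt0) -expr2 -rnorm_cstar_mul rnorm_cmul.
by apply/eqP; rewrite eq_le le_star -{2}(cstarK a) le_star.
Qed.

Lemma rnorm_sqr a : cstar a = a -> rnorm (a ⋅ a) = rnorm a ^+ 2.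
Proof. by move=> aa; rewrite -rnorm_cstar_mul aa. Qed.

Lemma rnorm_cone : rnorm (cone : A) <= 1.
Proof.
have := rnorm_sqr cstar1; rewrite cmul1l => h.
rewrite leNgt; apply/negP => h1.
have := lt_trans ltr01 h1 => h0.
by move: h1; rewrite -(ltr_pM2r h0) mul1r -expr2 -h ltxx.
Qed.

Lemma rnorm_scalar t : rnorm (t%:C *: (cone : A)) <= `|t|.
Proof. by rewrite rnormZr ler_piMr// rnorm_cone. Qed.

Lemma cvg_cmul (u v : nat -> A) a b :
  u @ \oo --> a -> v @ \oo --> b -> u n ⋅ v n @[n --> \oo] --> a ⋅ b.
Proof.
move=> ua vb; move/cvg_rnorm: (ua) => ua'; move/cvg_rnorm: (vb) => vb'.
apply: (@rnorm_squeeze _ _ _ _ _ _ _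
  (fun n => rnorm (u n - a) * rnorm (v n) + rnorm a * rnorm (v n - b))).
  move=> n; have -> : u n ⋅ v n - a ⋅ b = (u n - a) ⋅ v n + a ⋅ (v n - b).
    by rewrite cmulBl cmulBr addrA subrK.
  by rewrite (le_trans (rnormD _ _))// lerD// rnorm_cmul.
rewrite -[X in _ --> X](addr0 (0 : R)); apply: cvgD.
  by rewrite -[X in _ --> X](mul0r (rnorm b)); apply: cvgM => //; exact: cvg_rnormr.
by rewrite -[X in _ --> X](mulr0 (rnorm a)); apply: cvgMr.
Qed.

Lemma cvg_cmull (u : nat -> A) a b :
  u @ \oo --> a -> u n ⋅ b @[n --> \oo] --> a ⋅ b.
Proof. by move=> ua; apply: cvg_cmul => //; exact: cvg_cst. Qed.

Lemma cvg_cmulr (u : nat -> A) a b :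
  u @ \oo --> a -> b ⋅ u n @[n --> \oo] --> b ⋅ a.
Proof. by move=> ua; apply: cvg_cmul => //; exact: cvg_cst. Qed.

Lemma cvg_cstar (u : nat -> A) a :
  u @ \oo --> a -> cstar (u n) @[n --> \oo] --> cstar a.
Proof.
move=> /cvg_rnorm ua; apply: rnorm_squeeze ua => n.
by rewrite -cstarB rnorm_cstar.
Qed.

(** The multiplication of a C*-algebra being a bare operation, powers and
    geometric sums are defined directly. *)
Fixpoint cpow a n := if n is m.+1 then a ⋅ cpow a m else cone.

Lemma cpowD a m n : cpow a (m + n) = cpow a m ⋅ cpow a n.
Proof. by elim: m => [|m ih] /=; rewrite ?cmul1l// ih cmulA. Qed.

Lemma cpowSr a n : cpow a n.+1 = cpow a n ⋅ a.
Proof. by rewrite -addn1 cpowD /= cmul1r. Qed.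

Lemma rnorm_cpow a n : rnorm (cpow a n) <= rnorm a ^+ n.
Proof.
elim: n => [|n ih] /=; first by rewrite expr0 rnorm_cone.
by rewrite exprS (le_trans (rnorm_cmul _ _))// ler_wpM2l// rnorm_ge0.
Qed.

Definition cgeom a n := \sum_(k < n) cpow a k.

Lemma cgeomS a n : cgeom a n.+1 = cgeom a n + cpow a n.
Proof. by rewrite /cgeom big_ord_recr. Qed.

Lemma cgeom_mull a n : (cone - a) ⋅ cgeom a n = cone - cpow a n.
Proof.
elim: n => [|n ih]; first by rewrite /cgeom big_ord0 cmul0r subrr.
rewrite cgeomS /= cmulDr ih cmulBl cmul1l.
by rewrite addrA subrK.
Qed.

Lemma cgeom_mulr a n : cgeom a n ⋅ (cone - a) = cone - cpow a n.
Proof.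
elim: n => [|n ih]; first by rewrite /cgeom big_ord0 cmul0l subrr.
rewrite cgeomS cmulDl ih cmulBr cmul1r -cpowSr.
by rewrite addrA subrK.
Qed.

(** The inverse is the sum of the geometric series. *)
Lemma neumann a : rnorm a < 1 -> cinvertible (cone - a).
Proof.
move=> a1.
have [||l [ul _]] := @geometric_steps_cvg _ _ (cgeom a) 1 (rnorm a).
- by rewrite rnorm_ge0.
- by move=> n; rewrite cgeomS addrAC subrr add0r mul1r rnorm_cpow.
have pow0 : cone - cpow a n @[n --> \oo] --> cone.
  apply: (@rnorm_squeeze _ _ _ _ _ _ _ (fun n => rnorm a ^+ n)).
    by move=> n; rewrite addrAC subrr add0r rnormN rnorm_cpow.
  by apply: cvg_expr; rewrite ger0_norm// rnorm_ge0.
exists l; split.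
  apply: cvg_unique_seq pow0; under eq_fun do rewrite -cgeom_mull.
  exact: cvg_cmulr.
apply: cvg_unique_seq pow0; under eq_fun do rewrite -cgeom_mulr.
exact: cvg_cmull.
Qed.

Lemma cinvertibleM a b : cinvertible a -> cinvertible b -> cinvertible (a ⋅ b).
Proof.
move=> [a' [aa' a'a]] [b' [bb' b'b]]; exists (b' ⋅ a'); split.
  by rewrite cmulA -(cmulA a) bb' cmul1r.
by rewrite cmulA -(cmulA b') a'a cmul1r.
Qed.

Lemma cinvertibleZ k a : k != 0 -> cinvertible a -> cinvertible (k *: a).
Proof.
move=> k0 [b [ab ba]]; exists (k^-1 *: b); split.
  by rewrite cmulZl cmulZr scalerA divff// scale1r.
by rewrite cmulZl cmulZr scalerA mulVf// scale1r.
Qed.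

Lemma cinvertibleN a : cinvertible a -> cinvertible (- a).
Proof. by rewrite -scaleN1r; apply: cinvertibleZ; rewrite oppr_eq0 oner_eq0. Qed.

Lemma cinverse_comm a b c : a ⋅ b = cone -> b ⋅ a = cone ->
  a ⋅ c = c ⋅ a -> b ⋅ c = c ⋅ b.
Proof.
move=> ab ba ac.
by rewrite -[c in LHS]cmul1r -ab (cmulA c) -ac !cmulA ba cmul1l.
Qed.

Lemma cinverse_star a b : a ⋅ b = cone -> b ⋅ a = cone ->
  cstar a = a -> cstar b = b.
Proof.
move=> ab ba aa.
have h : cstar b ⋅ a = cone by rewrite -{1}aa -cstarM ab cstar1.
by rewrite -[LHS]cmul1r -ab cmulA h cmul1l.
Qed.

(** Otherwise [l^-1 *: a] has norm less than 1 and the geometric series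
    inverts [cone - l^-1 *: a]. *)
Lemma spectrum_norm a l : spectrum a l -> complex.Re `|l| <= rnorm a.
Proof.
move=> sl; rewrite leNgt; apply/negP => la; apply: sl.
have l0 : l != 0.
  by apply/eqP => l0; move: la; rewrite l0 normr0 ltNge rnorm_ge0.
have -> : l *: cone - a = l *: (cone - l^-1 *: a).
  by rewrite scalerBr scalerA divff// scale1r.
apply: cinvertibleZ => //; apply: neumann.
have lE : `|l| = (complex.Re `|l|)%:C by rewrite RRe_real// ger0_real.
have lgt0 : 0 < complex.Re `|l| by rewrite -ltcR -lE normr_gt0.
have -> : rnorm (l^-1 *: a) = (complex.Re `|l|)^-1 * rnorm a.
  by rewrite rnormZ normfV {1}lE -fmorphV.
by rewrite ltr_pdivrMl// mulr1.
Qed.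

Lemma spectrum_shift a k l : spectrum a l -> spectrum (a + k *: cone) (l + k).
Proof.
rewrite /spectrum/= => h; apply: contra_not h; congr cinvertible.
by rewrite scalerDl opprD addrACA subrr addr0.
Qed.

Lemma spectrumN a l : spectrum a l -> spectrum (- a) (- l).
Proof.
rewrite /spectrum/= => h; apply: contra_not h => /cinvertibleN; congr cinvertible.
by rewrite opprD scaleNr !opprK.
Qed.

(** Shifting [a] by the imaginary scalar [i t] moves a spectral value
    [x + i y] to [x + i (y + t)], while the C*-identity bounds the norm
    squared by [|a| ^ 2 + t ^ 2]; for large [t] this forces [y = 0]. *)
Lemma spectrum_real a l : cstar a = a -> spectrum a l -> complex.Im l = 0.
Proof.
move=> aa; case: l => x y sl /=.
pose N := rnorm a ^+ 2.
have key t : x ^+ 2 + (y + t) ^+ 2 <= N + t ^+ 2.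
  pose b := a + (t *i) *: cone.
  have sb : spectrum b ((x +i* y) + (t *i)) by exact: spectrum_shift.
  have bb : cstar b ⋅ b = a ⋅ a + (t ^+ 2)%:C *: cone.
    rewrite cstarD cstarZ aa cstar1 cmulDl !cmulDr !cmulZl !cmulZr cmul1l cmul1r.
    rewrite scalerA cmul1l.
    have -> : Num.conj (t *i) = - (t *i) :> R[i] by rewrite conjCE; simpc.
    have -> : - (t *i) * (t *i) = (t ^+ 2)%:C :> R[i] by simpc; rewrite expr2.
    by rewrite scaleNr -addrA (addrA (t *i *: a)) subrr add0r.
  have le1 : rnorm b ^+ 2 <= N + t ^+ 2.
    rewrite -rnorm_cstar_mul bb (le_trans (rnormD _ _))// rnorm_sqr// lerD2l.
    by rewrite (le_trans (rnorm_scalar _))// ger0_norm// sqr_ge0.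
  apply: le_trans le1.
  have := spectrum_norm sb; rewrite normc_def /= addr0 => le2.
  by rewrite -ler_sqrt ?sqr_ge0// sqrtr_sqr ger0_norm ?rnorm_ge0.
apply/eqP/negP => /negP y0.
have := key ((N + 1) / (2 * y)).
have -> : (y + (N + 1) / (2 * y)) ^+ 2 =
    y ^+ 2 + (N + 1) + ((N + 1) / (2 * y)) ^+ 2 by field.
have : 0 <= x ^+ 2 := sqr_ge0 _.
have : 0 <= y ^+ 2 := sqr_ge0 _.
lra.
Qed.

End CStarBasics.

Arguments spectrum_shift {R A a} k {l}.

(** * Self-adjoint elements attain their norm on the spectrum *)

Section NormIsSpectral.
Context {R : realType} {A : cstarAlgebraType R}.
Implicit Types (a b p q w : A).

Lemma cpow_comm a b n : a ⋅ b = b ⋅ a -> cpow a n ⋅ b = b ⋅ cpow a n.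
Proof.
move=> ab; elim: n => [|n ih] /=; first by rewrite cmul1l cmul1r.
by rewrite -cmulA ih !cmulA ab.
Qed.

Lemma cgeom_comm a b n : a ⋅ b = b ⋅ a -> cgeom a n ⋅ b = b ⋅ cgeom a n.
Proof.
move=> ab; elim: n => [|n ih]; first by rewrite /cgeom big_ord0 cmul0l cmul0r.
by rewrite cgeomS cmulDl ih cpow_comm// cmulDr.
Qed.

Lemma cpow_star a n : cstar a = a -> cstar (cpow a n) = cpow a n.
Proof.
move=> aa; elim: n => [|n ih] /=; first exact: cstar1.
by rewrite cstarM ih aa cpow_comm.
Qed.

Lemma cgeom_star a n : cstar a = a -> cstar (cgeom a n) = cgeom a n.
Proof.
move=> aa; elim: n => [|n ih]; first by rewrite /cgeom big_ord0 cstar0.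
by rewrite cgeomS cstarD ih cpow_star.
Qed.

Lemma cstar_mul_comm a b : cstar a = a -> cstar b = b -> a ⋅ b = b ⋅ a ->
  cstar (a ⋅ b) = a ⋅ b.
Proof. by move=> aa bb ab; rewrite cstarM aa bb ab. Qed.

Lemma cpow_sqr b n : cpow (b ⋅ b) n = cpow b n ⋅ cpow b n.
Proof.
elim: n => [|n ih] /=; first by rewrite cmul1l.
rewrite ih -!cmulA; congr (b ⋅ _); rewrite !cmulA; congr (_ ⋅ _).
by rewrite cpow_comm.
Qed.

Lemma cgeom_double a n : cgeom a (n + n) = cgeom a n + cpow a n ⋅ cgeom a n.
Proof.
rewrite {1}/cgeom big_split_ord/=; congr (_ + _).
suff h m : \sum_(i < m) cpow a (n + i) = cpow a n ⋅ cgeom a m by exact: h.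
elim: m => [|m ih]; first by rewrite /cgeom !big_ord0 cmul0r.
by rewrite big_ord_recr /= ih cgeomS cmulDr cpowD.
Qed.

(** [2 p] is the sum of [p + i q] and its adjoint, whose squared norm is
    [|p ^ 2 + q ^ 2|] by the C*-identity. *)
Lemma rnorm_sum_sqr p q : cstar p = p -> cstar q = q -> p ⋅ q = q ⋅ p ->
  rnorm p ^+ 2 <= rnorm (p ⋅ p + q ⋅ q).
Proof.
move=> pp qq pq.
pose j : R[i] := 0 +i* 1.
have jj : j * j = -1 by exact: sqr_i.
pose z := p + j *: q.
have zs : cstar z = p - j *: q.
  rewrite cstarD cstarZ pp qq -scaleNr conjCE; congr (_ + _ *: _).
  by rewrite /j /=; simpc.
have zz : cstar z ⋅ z = p ⋅ p + q ⋅ q.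
  rewrite zs /z cmulBl !cmulDr !cmulZl !cmulZr scalerA jj pq.
  by rewrite scaleN1r opprD opprK addrA addrK.
rewrite -zz rnorm_cstar_mul ler_sqr ?nnegrE ?rnorm_ge0//.
have : rnorm (2%:C *: p) <= rnorm z + rnorm (cstar z).
  suff -> : 2%:C *: p = z + cstar z by exact: rnormD.
  by rewrite zs addrACA subrr addr0 rmorphD/= scalerDl scale1r.
rewrite rnorm_cstar rnormZr ger0_norm//; lra.
Qed.

(** [(p + q) ^ 2 = (2 w) ^ 2 + (p - q) ^ 2]. *)
Lemma rnorm_add_sqr p q w : cstar p = p -> cstar q = q -> cstar w = w ->
  p ⋅ q = w ⋅ w -> q ⋅ p = w ⋅ w -> w ⋅ p = p ⋅ w -> w ⋅ q = q ⋅ w ->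
  2 * rnorm w <= rnorm (p + q).
Proof.
move=> pp qq ww pq qp wp wq.
have sq : (p + q) ⋅ (p + q) = (w + w) ⋅ (w + w) + (p - q) ⋅ (p - q).
  rewrite !cmulBl !cmulDl !cmulBr !cmulDr pq qp opprB.
  set P := p ⋅ p; set Q := q ⋅ q; set W := w ⋅ w.
  rewrite [RHS]addrACA (addrACA W W P) (addrACA W W Q) subrr !addr0.
  by rewrite (addrC P).
have /= := @rnorm_sum_sqr (w + w) (p - q).
rewrite cstarD cstarB ww pp qq -sq => /(_ erefl erefl) h.
have {}h : rnorm (w + w) ^+ 2 <= rnorm (p + q) ^+ 2.
  rewrite -[X in _ <= X]rnorm_sqr; last by rewrite cstarD pp qq.
  by apply: h; rewrite cmulDl cmulBl !cmulBr !cmulDr wp wq opprD addrACA.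
move: h; rewrite ler_sqr ?nnegrE ?rnorm_ge0//; apply: le_trans.
have -> : w + w = 2%:C *: w by rewrite rmorphD/= scalerDl scale1r.
by rewrite rnormZr ger0_norm.
Qed.

(** The powers [b ^ (2 ^ k)] have norm [1] by the C*-identity, and every power
    divides one of them. *)
Lemma rnorm_cpow1 b n : cstar b = b -> rnorm b = 1 -> 1 <= rnorm (cpow b n).
Proof.
move=> bb b1.
have two k : rnorm (cpow b (2 ^ k)) = 1.
  elim: k => [|k ih]; first by rewrite expn0 /= cmul1r.
  by rewrite expnS mul2n -addnn cpowD rnorm_sqr ?cpow_star// ih expr1n.
have nk : (n <= 2 ^ n)%N by rewrite ltnW// ltn_expl.
rewrite -(two n) -(subnKC nk) cpowD (le_trans (rnorm_cmul _ _))//.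
rewrite ler_piMr ?rnorm_ge0// (le_trans (rnorm_cpow _ _))// b1 expr1n//.
Qed.

(** [S_2n b ^ j = S_n b ^ j + b ^ 2n S_n b ^ j], where [S_n] is the sum of the
    first [n] even powers of [b], has at least twice the norm of
    [S_n b ^ (n + j)]. *)
Lemma rnorm_cgeom_sqr b k j : cstar b = b -> rnorm b = 1 ->
  2 ^+ k <= rnorm (cgeom (b ⋅ b) (2 ^ k) ⋅ cpow b j).
Proof.
move=> bb b1; elim: k j => [|k ih] j.
  rewrite expn0 expr0 /cgeom big_ord1 /= cmul1l; exact: rnorm_cpow1.
set n := (2 ^ k)%N.
rewrite exprS expnS mul2n -addnn cgeom_double cmulDl.
set S := cgeom _ _.
have bbS : cstar (b ⋅ b) = b ⋅ b by rewrite cstarM bb.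
have SS : cstar S = S by apply: cgeom_star.
have Sb : S ⋅ b = b ⋅ S by rewrite cgeom_comm// cmulA.
have SP i : S ⋅ cpow b i = cpow b i ⋅ S by rewrite -cpow_comm.
have PP i l : cpow b i ⋅ cpow b l = cpow b l ⋅ cpow b i by rewrite -!cpowD addnC.
have P2 : cpow (b ⋅ b) n = cpow b (n + n) by rewrite cpow_sqr cpowD.
have form i l : (S ⋅ cpow b i) ⋅ (S ⋅ cpow b l) = S ⋅ S ⋅ cpow b (i + l).
  by rewrite -!cmulA (cmulA (cpow b i)) -SP -!cmulA cpowD.
have star i : cstar (S ⋅ cpow b i) = S ⋅ cpow b i.
  by apply: cstar_mul_comm => //; exact: cpow_star.
have -> : cpow (b ⋅ b) n ⋅ S ⋅ cpow b j = S ⋅ cpow b (n + n + j).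
  by rewrite P2 -SP -cmulA -cpowD.
have /= := @rnorm_add_sqr (S ⋅ cpow b j) (S ⋅ cpow b (n + n + j)) (S ⋅ cpow b (n + j)).
rewrite !form !star => h; apply: le_trans (h _ _ _ _ _ _ _) => //.
- by rewrite ler_pM2l// ih.
- by congr (_ ⋅ cpow b _); lia.
- by congr (_ ⋅ cpow b _); lia.
- by congr (_ ⋅ cpow b _); lia.
- by congr (_ ⋅ cpow b _); lia.
Qed.

(** With [c] inverse to [1 - b ^ 2], the partial sum
    [1 + b ^ 2 + ... + b ^ (2n - 2) = c (1 - b ^ 2n)] would stay bounded. *)
Lemma not_cinvertible_1Bsqr b : cstar b = b -> rnorm b = 1 ->
  ~ cinvertible (cone - b ⋅ b).
Proof.
move=> bb b1 [c [_ ca]].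
have bound n : rnorm (cgeom (b ⋅ b) n) <= rnorm c * 2.
  have -> : cgeom (b ⋅ b) n = c ⋅ (cone - cpow (b ⋅ b) n).
    by rewrite -cgeom_mull cmulA ca cmul1l.
  rewrite (le_trans (rnorm_cmul _ _))// ler_wpM2l ?rnorm_ge0//.
  rewrite (le_trans (rnormD _ _))// rnormN lerD ?rnorm_cone//.
  rewrite (le_trans (rnorm_cpow _ _))// exprn_ile1 ?rnorm_ge0//.
  by rewrite (le_trans (rnorm_cmul _ _))// b1 mulr1.
have x0 : 0 <= rnorm c * 2 by rewrite mulr_ge0// rnorm_ge0.
pose k := Num.bound (rnorm c * 2).
have := archi_boundP x0; rewrite -/k => hk.
have := @rnorm_cgeom_sqr b k 0 bb b1; rewrite /= cmul1r => h.
have := le_trans h (bound _); apply/negP; rewrite -ltNge.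
apply: (lt_le_trans hk); rewrite -natrX ler_nat ltnW// ltn_expl//.
Qed.

(** Let [e = b / |b|]. Were neither [|b|] nor [- |b|] a spectral value, both factors
    of [1 - e ^ 2 = (1 - e) (1 + e)] would be invertible. *)
Lemma norm_in_spectrum b : cstar b = b -> 0 < rnorm b ->
  spectrum b (rnorm b)%:C \/ spectrum b (- (rnorm b)%:C).
Proof.
move=> bb b0; apply: contrapT => /not_orP[/contrapT h1 /contrapT h2].
set s := rnorm b in b0 h1 h2.
have s0 : s%:C != 0 :> R[i] by rewrite gt_eqF// ltcR.
pose e := s%:C^-1 *: b.
have sV : s%:C^-1 = (s^-1)%:C :> R[i] by rewrite -fmorphV.
have ee : cstar e = e by rewrite /e sV cstarZr bb.
have e1 : rnorm e = 1.
  by rewrite /e sV rnormZr ger0_norm ?invr_ge0 ?ltW// mulVf// gt_eqF.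
apply: (not_cinvertible_1Bsqr ee e1).
have -> : cone - e ⋅ e = (cone - e) ⋅ (cone + e).
  by rewrite cmulBl !cmulDr cmul1l !cmul1r cmul1l opprD addrA addrK.
have isV : s%:C^-1 != 0 :> R[i] by rewrite invr_eq0.
apply: cinvertibleM.
  have -> : cone - e = s%:C^-1 *: (s%:C *: cone - b).
    by rewrite scalerBr scalerA mulVf// scale1r.
  exact: cinvertibleZ.
have -> : cone + e = - s%:C^-1 *: (- s%:C *: cone - b).
  by rewrite scalerBr scalerA mulrNN mulVf// scale1r scaleNr opprK.
by apply: cinvertibleZ => //; rewrite oppr_eq0.
Qed.

End NormIsSpectral.

(** * The positive cone of a C*-algebra *)

Section PositiveCone.
Context {R : realType} {A : cstarAlgebraType R}.
Implicit Types (a b c p q s w x : A) (t e : R).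

Lemma cpositive_star a : cpositive a -> cstar a = a.
Proof. by case. Qed.

Lemma cstar_scalar t : cstar (t%:C *: (cone : A)) = t%:C *: cone.
Proof. by rewrite cstarZr cstar1. Qed.

Lemma cpositive_inv a : cstar a = a ->
  (forall t, 0 < t -> cinvertible (a + t%:C *: cone)) -> cpositive a.
Proof.
move=> aa inv; split=> // l sl.
have Il := spectrum_real aa sl.
have lE : l = (complex.Re l)%:C by case: l Il {sl} => x y /= ->.
rewrite lE ler0c leNgt; apply/negP => l0; apply: sl.
have := inv (- complex.Re l); rewrite oppr_gt0 => /(_ l0) /cinvertibleN.
by congr cinvertible; rewrite rmorphN/= -lE scaleNr opprB.
Qed.

Lemma cinvertible_cpositive a t : cpositive a -> 0 < t ->
  cinvertible (a + t%:C *: cone).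
Proof.
move=> [_ pos] t0; apply: contrapT => ninv.
have /pos : spectrum a (- t%:C).
  move=> /cinvertibleN h; apply: ninv; move: h; congr cinvertible.
  by rewrite scaleNr opprB opprK.
by rewrite -rmorphN ler0c oppr_ge0 leNgt t0.
Qed.

(** For self-adjoint [a] and [t >= |a|], positivity of [a] amounts to
    [|t - a| <= t]; this lemma and the next one are the two directions. *)
Lemma cpositive_of_norm a t : cstar a = a ->
  rnorm (t%:C *: cone - a) <= t -> cpositive a.
Proof.
move=> aa le_t; apply: cpositive_inv => // e e0; apply: contrapT => ninv.
have sl : spectrum a (- e%:C).
  move=> /cinvertibleN h; apply: ninv; move: h; congr cinvertible.
  by rewrite scaleNr opprB opprK.
have := spectrum_norm (spectrum_shift t%:C (spectrumN sl)).
rewrite opprK -rmorphD Re_norm_real (addrC (- a)) => h.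
have := le_trans (ler_norm _) (le_trans h le_t); lra.
Qed.

Lemma cpositive_norm a t : cpositive a -> rnorm a <= t ->
  rnorm (t%:C *: cone - a) <= t.
Proof.
move=> [aa pos] at_; rewrite leNgt; apply/negP => tb.
set b := t%:C *: cone - a in tb.
have t0 : 0 <= t by rewrite (le_trans _ at_)// rnorm_ge0.
have bb : cstar b = b by rewrite cstarB cstar_scalar aa.
have aE : a = - b + t%:C *: cone by rewrite opprB subrK.
(* Were [|b| > t], [a = t - b] would have a negative spectral value [t - |b|], or
   the spectral value [t + |b|], larger than [|a|]. *)
case: (norm_in_spectrum bb (le_lt_trans t0 tb)) => sb.
  have := spectrum_shift t%:C (spectrumN sb); rewrite -aE => /pos.
  by rewrite -rmorphN -rmorphD/= ler0c; lra.
have := spectrum_shift t%:C (spectrumN sb); rewrite -aE opprK => /spectrum_norm.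
rewrite -rmorphD Re_norm_real => h.
have := le_trans (ler_norm _) h; lra.
Qed.

(** [|(s + t) - (a + b)| <= |s - a| + |t - b|]. *)
Lemma cpositiveD a b : cpositive a -> cpositive b -> cpositive (a + b).
Proof.
move=> pa pb; apply: (@cpositive_of_norm _ (rnorm a + rnorm b)).
  by rewrite cstarD !cpositive_star.
rewrite rmorphD/= scalerDl opprD addrACA (le_trans (rnormD _ _))//.
by rewrite lerD// cpositive_norm.
Qed.

Lemma cpositive_scalar t : 0 <= t -> cpositive (t%:C *: (cone : A)).
Proof.
move=> t0; apply: (@cpositive_of_norm _ t); first exact: cstar_scalar.
by rewrite subrr rnorm0.
Qed.

Lemma cpositiveZ a t : 0 <= t -> cpositive a -> cpositive (t%:C *: a).
Proof.
move=> t0 pa; apply: (@cpositive_of_norm _ (t * rnorm a)).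
  by rewrite cstarZr cpositive_star.
rewrite rmorphM/= -scalerA -scalerBr rnormZr ger0_norm// ler_wpM2l//.
exact: cpositive_norm.
Qed.

(** The criterion [|t - a| <= t] passes to the limit, as [t] can be chosen
    uniformly in [e]. *)
Lemma cpositive_closed a c : cstar a = a -> cstar c = c ->
  (forall e, 0 < e -> cpositive (a + e%:C *: c)) -> cpositive a.
Proof.
move=> aa cc pos; set t := rnorm a + rnorm c.
apply: (@cpositive_of_norm _ t) => //; apply/ler_addgt0Pr => d d0.
have N0 : 0 < rnorm c + 1 by rewrite ltr_wpDl ?rnorm_ge0.
pose e := Num.min 1 (d / (rnorm c + 1)).
have e0 : 0 < e by rewrite lt_min ltr01 divr_gt0.
have ed : e * rnorm c <= d.
  rewrite (@le_trans _ _ (e * (rnorm c + 1)))//.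
    by rewrite ler_wpM2l ?ltW//; lra.
  by rewrite -ler_pdivlMr// ge_min lexx orbT.
have e1 : e * rnorm c <= rnorm c.
  by rewrite ler_piMl ?rnorm_ge0// ge_min lexx.
have := @cpositive_norm _ t (pos _ e0) => h.
have {}h : rnorm (t%:C *: cone - (a + e%:C *: c)) <= t.
  apply: h; rewrite (le_trans (rnormD _ _))// lerD2l rnormZr ger0_norm//.
  exact: ltW.
have -> : t%:C *: cone - a = (t%:C *: cone - (a + e%:C *: c)) + e%:C *: c.
  by rewrite opprD addrA subrK.
rewrite (le_trans (rnormD _ _))// lerD// rnormZr ger0_norm//; exact: ltW.
Qed.

(** [s ^ 2 + e ^ 2 = (s + i e) (s - i e)] and spectral values of [s] are real. *)
Lemma cpositive_sqr s : cstar s = s -> cpositive (s ⋅ s).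
Proof.
move=> ss; apply: cpositive_inv => [|t t0]; first by rewrite cstarM ss.
have inv (k : R) : k != 0 -> cinvertible (s - (0 +i* k) *: cone).
  move=> k0; apply: contrapT => ninv.
  have /(spectrum_real ss) /= /eqP : spectrum s (0 +i* k).
    by move=> /cinvertibleN; rewrite opprB.
  by rewrite (negbTE k0).
pose k := Num.sqrt t.
have k0 : k != 0 by rewrite gt_eqF// sqrtr_gt0.
have -> : s ⋅ s + t%:C *: cone =
    (s - (0 +i* k) *: cone) ⋅ (s - (0 +i* (- k)) *: cone).
  rewrite cmulBl !cmulBr !cmulZl !cmulZr cmul1l !cmul1r scalerA.
  have -> : (0 +i* k) * (0 +i* (- k)) = t%:C :> R[i].
    by simpc; rewrite -expr2 sqr_sqrtr// ltW.
  have -> : 0 +i* - k = - (0 +i* k) :> R[i] by simpc.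
  by rewrite scaleNr opprB opprK [RHS]addrACA subrr addr0.
by apply: cinvertibleM; apply: inv; rewrite ?oppr_eq0.
Qed.

(** Spectral values of the inverse are inverses of spectral values, hence at
    least [1 / |a|]. *)
Lemma cpositive_inverse_lower a b : cpositive a -> a ⋅ b = cone -> b ⋅ a = cone ->
  exists2 e, 0 < e & cpositive (b - e%:C *: cone).
Proof.
move=> [aa pos] ab ba.
have bb := cinverse_star ab ba aa.
have N0 : 0 < rnorm a + 1 by rewrite ltr_wpDl ?rnorm_ge0.
exists (rnorm a + 1)^-1; first by rewrite invr_gt0.
set e := (_ + _)^-1.
have be : cstar (b - e%:C *: cone) = b - e%:C *: cone.
  by rewrite cstarB cstar_scalar bb.
split=> // l sl.
have := spectrum_shift e%:C sl; rewrite subrK => sb.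
have Il := spectrum_real be sl.
have lE : l = (complex.Re l)%:C by case: l Il {sl sb} => x y /= ->.
set m := complex.Re l + e.
have mE : l + e%:C = m%:C by rewrite lE -rmorphD.
rewrite mE in sb.
have m0 : m%:C != 0 :> R[i].
  apply/eqP => m0; apply: sb; rewrite m0 scale0r sub0r; apply: cinvertibleN.
  by exists a.
have sa : spectrum a (m%:C^-1).
  move=> inv; apply: sb.
  have -> : m%:C *: cone - b = (- m%:C) *: (b ⋅ (m%:C^-1 *: cone - a)).
    rewrite cmulBr cmulZr cmul1r ba scalerBr scalerA mulNr divff// scaleN1r.
    by rewrite scaleNr opprK addrC.
  by apply: cinvertibleZ; rewrite ?oppr_eq0//; apply: cinvertibleM => //; exists a.
have mV : m%:C^-1 = (m^-1)%:C :> R[i] by rewrite -fmorphV.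
have := pos _ sa; rewrite mV ler0c invr_ge0 le_eqVlt eq_sym.
move: (m0); rewrite -(inj_eq (@complexI _)) => /negbTE -> /= mgt0.
have := spectrum_norm sa; rewrite mV Re_norm_real.
rewrite ger0_norm; last by rewrite invr_ge0 ltW.
move=> mle.
rewrite lE ler0c -(lerD2r e) add0r -/m /e invf_ple ?posrE//.
by rewrite (le_trans mle)// lerDl.
Qed.

(** [s x s + e = s (x + e s ^ -2) s], and [s ^ -2] is bounded below. *)
Lemma cpositive_conj s x : cstar s = s -> cinvertible s -> cpositive x ->
  cpositive (s ⋅ x ⋅ s).
Proof.
move=> ss sinv xpos; have [r [sr rs]] := sinv.
have xx := cpositive_star xpos.
have rr := cinverse_star sr rs ss.
apply: cpositive_inv => [|e e0]; first by rewrite !cstarM ss xx cmulA.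
have [d d0 dpos] : exists2 d, 0 < d & cpositive (r ⋅ r - d%:C *: cone).
  apply: (@cpositive_inverse_lower (s ⋅ s)); first exact: cpositive_sqr.
    by rewrite cmulA -(cmulA s) sr cmul1r.
  by rewrite cmulA -(cmulA r) rs cmul1r.
have -> : s ⋅ x ⋅ s + e%:C *: cone = s ⋅ (x + e%:C *: (r ⋅ r)) ⋅ s.
  rewrite cmulDr cmulDl; congr (_ + _).
  by rewrite cmulZr cmulZl cmulA sr cmul1l rs.
apply: cinvertibleM => //; apply: cinvertibleM => //.
have -> : x + e%:C *: (r ⋅ r) =
    (x + e%:C *: (r ⋅ r - d%:C *: cone)) + (e * d)%:C *: cone.
  by rewrite scalerBr scalerA -rmorphM addrA subrK.
apply: cinvertible_cpositive; last by rewrite mulr_gt0.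
by apply: cpositiveD => //; apply: cpositiveZ => //; rewrite ltW.
Qed.

(** For invertible [a] with inverse [h], [a b + e = a (b + e h)] and [h] is
    bounded below; the general case follows by perturbing [a] to [a + d]. *)
Lemma cpositiveM a b : cpositive a -> cpositive b -> a ⋅ b = b ⋅ a ->
  cpositive (a ⋅ b).
Proof.
move=> pa pb ab.
have aa := cpositive_star pa; have bb := cpositive_star pb.
apply: (@cpositive_closed _ b) => //; first by apply: cstar_mul_comm.
move=> d d0; pose ad := a + d%:C *: cone.
have pad : cpositive ad by apply: cpositiveD => //; apply: cpositive_scalar; rewrite ltW.
have -> : a ⋅ b + d%:C *: b = ad ⋅ b by rewrite cmulDl cmulZl cmul1l.
have adb : ad ⋅ b = b ⋅ ad by rewrite cmulDl cmulDr ab cmulZl cmulZr cmul1l cmul1r.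
have adinv := cinvertible_cpositive pa d0; have [h [ah ha]] := adinv.
have [k k0 pk] := cpositive_inverse_lower pad ah ha.
apply: cpositive_inv => [|e e0].
  by apply: cstar_mul_comm => //; exact: cpositive_star.
have -> : ad ⋅ b + e%:C *: cone = ad ⋅ (b + e%:C *: h).
  by rewrite cmulDr cmulZr ah.
apply: cinvertibleM => //.
have -> : b + e%:C *: h = (b + e%:C *: (h - k%:C *: cone)) + (e * k)%:C *: cone.
  by rewrite scalerBr scalerA -rmorphM addrA subrK.
apply: cinvertible_cpositive; last by rewrite mulr_gt0.
by apply: cpositiveD => //; apply: cpositiveZ => //; rewrite ltW.
Qed.

(** The iteration [y := ((1 - a) + y ^ 2) / 2] is contracting on the ball of
    radius [|1 - a|], and [1 - y] is a square root of [a] for its fixed point. *)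
Lemma csqrt a : cstar a = a -> rnorm (cone - a) < 1 ->
  exists s, [/\ cstar s = s, s ⋅ s = a & cinvertible s].
Proof.
move=> aa; set x := cone - a => x1.
have xx : cstar x = x by rewrite cstarB cstar1 aa.
have half : 0 <= (2^-1 : R) by rewrite invr_ge0.
pose g y := (2^-1 : R)%:C *: (x + y ⋅ y).
pose u n := iter n g 0.
have uu n : cstar (u n) = u n.
  elim: n => [|n ih]; first exact: cstar0.
  by rewrite /u /= -/(u n) cstarZr cstarD cstarM ih xx.
have ux n : rnorm (u n) <= rnorm x.
  elim: n => [|n ih]; first by rewrite /u/= rnorm0 rnorm_ge0.
  rewrite /u /= -/(u n) rnormZr ger0_norm//.
  have : rnorm (x + u n ⋅ u n) <= rnorm x + rnorm (u n) ^+ 2.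
    by rewrite (le_trans (rnormD _ _))// lerD2l rnorm_sqr.
  have : rnorm (u n) ^+ 2 <= rnorm x.
    have := rnorm_ge0 (u n); have := rnorm_ge0 x; nra.
  lra.
have ustep n : rnorm (u n.+2 - u n.+1) <= rnorm x * rnorm (u n.+1 - u n).
  rewrite /u !iterS -/(u n) -/(g (u n)); set y := g (u n); set z := u n.
  have -> : g y - g z = (2^-1 : R)%:C *: (y ⋅ (y - z) + (y - z) ⋅ z).
    rewrite /g -scalerBr opprD addrACA subrr add0r; congr (_ *: _).
    by rewrite cmulBr cmulBl addrA subrK.
  rewrite rnormZr ger0_norm//.
  have h1 : rnorm (y ⋅ (y - z)) <= rnorm x * rnorm (y - z).
    rewrite (le_trans (rnorm_cmul _ _))// ler_wpM2r ?rnorm_ge0//.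
    exact: (ux n.+1).
  have h2 : rnorm ((y - z) ⋅ z) <= rnorm x * rnorm (y - z).
    rewrite (le_trans (rnorm_cmul _ _))// mulrC ler_wpM2r ?rnorm_ge0//.
    exact: (ux n).
  have := rnormD (y ⋅ (y - z)) ((y - z) ⋅ z); lra.
have [||l [ul _]] := @geometric_steps_cvg _ _ u (rnorm (u 1%N - u 0%N)) (rnorm x).
- by rewrite rnorm_ge0.
- elim=> [|n ih]; first by rewrite expr0 mulr1.
  rewrite (le_trans (ustep n))// exprS mulrCA ler_wpM2l ?rnorm_ge0//.
have lfix : l = g l.
  have h : u n.+1 @[n --> \oo] --> l by rewrite (cvg_shiftS u).
  apply: cvg_unique_seq h _; rewrite /u /=.
  apply: cvgZr; apply: cvgD; first exact: cvg_cst.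
  exact: cvg_cmul.
have ll : cstar l = l.
  have := cvg_cstar ul; under eq_fun do rewrite uu.
  by move=> h; exact: cvg_unique_seq h ul.
exists (cone - l).
have sq : (cone - l) ⋅ (cone - l) = a.
  have l2 : l ⋅ l = l + l - x.
    rewrite {3 4}lfix /g -scalerDl -rmorphD/=.
    have -> : 2^-1 + 2^-1 = 1 :> R by lra.
    by rewrite scale1r addrC addKr.
  rewrite cmulBl !cmulBr cmul1l cmul1r cmul1l l2.
  by rewrite opprB (addrAC _ (- x)) addrK subrKA subKr.
split=> //; first by rewrite cstarB cstar1 ll.
have [b [ab ba]] : cinvertible a by rewrite -(subKr cone a); exact: neumann.
have bs : b ⋅ (cone - l) = (cone - l) ⋅ b.
  by apply: (cinverse_comm ab ba); rewrite -sq cmulA.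
exists (b ⋅ (cone - l)); split.
  by rewrite bs cmulA sq.
by rewrite -cmulA sq.
Qed.

(** Conjugating by [(p + e) ^ (-1/2)] turns the hypothesis into a norm bound
    [C] for [w], that is, into an inequality between [w] and the scalar [C];
    conjugating back by [(p + e) ^ (1/2)] and letting [e] tend to [0] gives the
    conclusion. *)
Lemma cpositive_of_form p w (C : R) : 0 <= C -> cpositive p -> cstar w = w ->
  (forall a, cstar a = a -> rnorm (a ⋅ w ⋅ a) <= C * rnorm (a ⋅ p ⋅ a)) ->
  cpositive (C%:C *: p - w).
Proof.
move=> C0 pp ww bound.
have pst := cpositive_star pp.
apply: (@cpositive_closed _ (C%:C *: cone)).
- by rewrite cstarB cstarZr pst ww.
- exact: cstar_scalar.
move=> e e0.
pose x := p + e%:C *: cone; pose t := rnorm p + e.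
have t0 : 0 < t by rewrite ltr_wpDl// rnorm_ge0.
have tC : t%:C != 0 :> R[i] by rewrite gt_eqF// ltcR.
have tV : t%:C^-1 = (t^-1)%:C :> R[i] by rewrite -fmorphV.
have xst : cstar x = x by rewrite cstarD pst cstar_scalar.
have px : cpositive x by apply: cpositiveD => //; apply: cpositive_scalar; rewrite ltW.
have [||s [ss sx sinv]] := @csqrt (t%:C^-1 *: x).
- by rewrite tV cstarZr xst.
- have -> : cone - t%:C^-1 *: x = (t^-1)%:C *: ((rnorm p)%:C *: cone - p).
    rewrite -tV -[cone in LHS]scale1r -(mulVf tC) -scalerA -scalerBr.
    by rewrite /t rmorphD/= scalerDl /x opprD addrACA subrr addr0.
  rewrite rnormZr ger0_norm; last by rewrite invr_ge0 ltW.
  rewrite ltr_pdivrMl// mulr1.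
  have := cpositive_norm pp (lexx _); rewrite /t; lra.
have [r [sr rs]] := sinv.
have rr := cinverse_star sr rs ss.
have xE : x = t%:C *: (s ⋅ s) by rewrite sx scalerA divff// scale1r.
have rxr : r ⋅ x ⋅ r = t%:C *: cone.
  by rewrite xE cmulZr cmulZl cmulA rs cmul1l sr.
have prpr : cpositive (r ⋅ p ⋅ r) by apply: cpositive_conj => //; exists s.
(* [0 <= r p r <= r x r = t], and the norm is a spectral value. *)
have rnp : rnorm (r ⋅ p ⋅ r) <= t.
  have pE : t%:C *: cone - r ⋅ p ⋅ r = e%:C *: (r ⋅ r).
    rewrite -rxr -cmulBl -cmulBr /x addrAC subrr add0r.
    by rewrite cmulZr cmulZl cmul1r.
  have prr : cpositive (t%:C *: cone - r ⋅ p ⋅ r).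
    by rewrite pE; apply: cpositiveZ; [rewrite ltW|exact: cpositive_sqr].
  rewrite leNgt; apply/negP => tn.
  have := norm_in_spectrum (cpositive_star prpr) (lt_trans t0 tn).
  case=> [sp|/prpr.2].
    have := spectrum_shift t%:C (spectrumN sp).
    by rewrite addrC => /prr.2; rewrite addrC -rmorphB ler0c subr_ge0 leNgt tn.
  by rewrite -rmorphN ler0c oppr_ge0 leNgt (lt_trans t0 tn).
have -> : C%:C *: p - w + e%:C *: (C%:C *: cone) =
    s ⋅ ((C * t)%:C *: cone - r ⋅ w ⋅ r) ⋅ s.
  rewrite cmulBr cmulBl !cmulA sr cmul1l -(cmulA w) rs cmul1r.
  rewrite cmulZr cmulZl cmul1r rmorphM/= -scalerA -xE /x scalerDr !scalerA.
  by rewrite mulrC addrAC.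
apply: cpositive_conj => //; apply: (@cpositive_of_norm _ (C * t)).
  by rewrite cstarB cstar_scalar !cstarM rr ww cmulA.
rewrite subKr (le_trans (bound _ rr))// ler_wpM2l//.
Qed.

(** [2 (C ^ 2 p q - u v) = (C p - u) (C q + v) + (C p + u) (C q - v)]. *)
Lemma cpositive_mul_bounds p q u v (C : R) :
  cpositive (C%:C *: p - u) -> cpositive (C%:C *: p + u) ->
  cpositive (C%:C *: q - v) -> cpositive (C%:C *: q + v) ->
  p ⋅ q = q ⋅ p -> p ⋅ v = v ⋅ p -> u ⋅ q = q ⋅ u -> u ⋅ v = v ⋅ u ->
  cpositive ((C ^+ 2)%:C *: (p ⋅ q) - u ⋅ v).
Proof.
move=> pu1 pu2 qv1 qv2 pq pv uq uv.
have -> : (C ^+ 2)%:C *: (p ⋅ q) - u ⋅ v =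
    (2^-1)%:C *: ((C%:C *: p - u) ⋅ (C%:C *: q + v) +
                  (C%:C *: p + u) ⋅ (C%:C *: q - v)).
  set P := C%:C *: p; set Q := C%:C *: q.
  have PQ : (C ^+ 2)%:C *: (p ⋅ q) = P ⋅ Q.
    by rewrite cmulZl cmulZr scalerA -rmorphM.
  rewrite PQ cmulDl cmulDr !cmulBr cmulDl cmulNl cmulDl.
  set X := P ⋅ Q; set Y := u ⋅ v; set V := P ⋅ v; set W := u ⋅ Q.
  have -> : u ⋅ (Q + v) = W + Y by rewrite cmulDr.
  rewrite (addrACA (X + V)) -opprD (addrACA X V) (addrACA W Y) (addrC W V).
  rewrite addrKA opprD (addrACA X X) -{2 3}[X - Y]scale1r -scalerDl scalerA.
  by rewrite fmorphV rmorphD mulVf ?scale1r// gt_eqF// addr_gt0// ltcR ltr01.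
apply: cpositiveZ; first by rewrite invr_ge0.
apply: cpositiveD; apply: cpositiveM => //.
- rewrite cmulBl cmulBr !cmulDr !cmulDl !cmulZl !cmulZr.
  by rewrite ?cmulZl pq pv uq uv.
- rewrite cmulDl [RHS]cmulDr !cmulBr !cmulBl !cmulZl !cmulZr.
  by rewrite ?cmulZl pq pv uq uv.
Qed.
End PositiveCone.

(** * Simple maps and integrals of simple functions *)

Section SimpleMaps.
Context {d : measure_display} {T : measurableType d}.

(** [simple_fun] for maps to an arbitrary type. Several simple functions are
    handled at once as functions of one simple map, the tuple of their values. *)
Definition simple_map (U : Type) (h : T -> U) : Prop :=
  finite_set (range h) /\ forall u, measurable (h @^-1` [set u]).

Lemma simple_map_preimage (U : Type) (h : T -> U) (B : set U) :
  simple_map h -> measurable (h @^-1` B).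
Proof.
move=> [finh mh].
have -> : h @^-1` B = \bigcup_(u in range h `&` B) h @^-1` [set u].
  apply/seteqP; split=> [x Bx|x [u [_ Bu] /= hx]]; last by rewrite /= hx.
  by exists (h x) => //; split=> //; exists x.
by apply: fin_bigcup_measurable => //; exact: finite_setIl.
Qed.

Lemma simple_map_comp (U W : Type) (phi : U -> W) (h : T -> U) :
  simple_map h -> simple_map (phi \o h).
Proof.
move=> sh; split.
  have -> : range (phi \o h) = phi @` range h by rewrite image_comp.
  by apply: finite_image; case: sh.
by move=> w; rewrite comp_preimage; exact: simple_map_preimage.
Qed.

Lemma simple_map_pair (U W : Type) (h : T -> U) (g : T -> W) :
  simple_map h -> simple_map g -> simple_map (fun x => (h x, g x)).
Proof.
move=> [fh mh] [fg mg]; split.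
  apply: (@sub_finite_set _ _ (range h `*` range g)); last exact: finite_setX.
  by move=> _ [x _ <-]; split; exists x.
move=> [u w]; have -> : (fun x => (h x, g x)) @^-1` [set (u, w)] =
    h @^-1` [set u] `&` g @^-1` [set w].
  by apply/seteqP; split=> x /= [-> ->].
exact: measurableI.
Qed.

Lemma simple_map_measurable (R : realType) (h : T -> R) :
  simple_map h -> measurable_fun setT h.
Proof. by move=> sh _ B mB; rewrite setTI; exact: simple_map_preimage. Qed.

Definition values (U : choiceType) (h : T -> U) : {fset U} := fset_set (range h).

Lemma mem_values (U : choiceType) (h : T -> U) x : simple_map h -> h x \in values h.
Proof. by move=> [fh _]; rewrite in_fset_set// inE; exists x. Qed.

Lemma integral_simple_map (R : realType) (mu : {measure set T -> \bar R})
    (U : choiceType) (h : T -> U) (phi : U -> R) :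
  simple_map h -> (forall u, 0 <= phi u) ->
  (\int[mu]_x (phi (h x))%:E = \sum_(u <- values h) (phi u)%:E * mu (h @^-1` [set u]))%E.
Proof.
move=> sh phi0.
have decomp x : ((phi (h x))%:E =
    \sum_(u <- values h) (phi u)%:E * (\1_(h @^-1` [set u]) x)%:E)%E.
  rewrite (big_fsetD1 (h x)) ?mem_values//= indicE mem_set// mule1 big1_fset ?adde0// => u.
  rewrite in_fsetD1 => /andP[/eqP uh _] _; rewrite indicE memNset ?mule0// => /= hu.
  by apply: uh.
under eq_integral do rewrite decomp.
rewrite ge0_integral_sum//.
- apply: eq_bigr => u _; rewrite ge0_integralZl_EFin//.
  + by rewrite integral_indic ?setIT//; case: sh.
  + apply/measurable_EFinP; apply: measurable_indic; by case: sh.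
- move=> u; apply/measurable_EFinP; rewrite /=.
  apply: measurable_funM => //; apply: measurable_indic; by case: sh.
- by move=> u x _; rewrite mule_ge0 ?lee_fin.
Qed.

End SimpleMaps.

Section SimpleIntegral.
Context {d : measure_display} {T : measurableType d} {R : realType}.
Context {V : completeNormedModType R[i]}.
Variable mu : {measure set T -> \bar R}.

(** The integral of [phi \o h] computed along the fibers of [h] rather than
    along those of [phi \o h]. *)
Definition fiber_sum (U : choiceType) (h : T -> U) (phi : U -> V) : V :=
  \sum_(u <- values h) (fine (mu (h @^-1` [set u])))%:C *: phi u.

(** Grouping the values of [h] on which [phi] takes the same nonzero value. *)
Lemma simple_integral_comp (U : choiceType) (h : T -> U) (phi : U -> V) :
  simple_map h ->
  (forall u, phi u != 0 -> (mu (h @^-1` [set u]) < +oo)%E) ->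
  simple_integral mu (phi \o h) = fiber_sum h phi.
Proof.
move=> sh fin; have [fh mh] := sh.
have rE : range (phi \o h) = phi @` range h by rewrite image_comp.
rewrite /simple_integral fsbig_finite; last by rewrite rE; exact: finite_image.
rewrite rE fset_set_image// /fiber_sum (partition_big_imfset _ phi)/=.
apply: eq_bigr => v _.
have [->|v0] := eqVneq v 0.
  by rewrite scaler0 big1// => u /eqP ->; rewrite scaler0.
transitivity (\sum_(u <- values h | phi u == v) (fine (mu (h @^-1` [set u])))%:C *: v).
  rewrite -scaler_suml -rmorph_sum/=; congr (_%:C *: _).
  rewrite sum_fine => [|u /eqP pu]; last first.
    by rewrite ge0_fin_numE// fin// pu.
  congr fine; rewrite big_fset_condE/= -measure_fbigsetU/=; last 2 first.
  - by move=> u _.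
  - exact: trivIset_preimage1.
  congr (mu _); rewrite -bigcup_fset; apply/seteqP; split=> x /=.
    move=> hx; exists (h x) => //=; rewrite !inE/= mem_values//.
    by apply/eqP.
  by move=> [u /=]; rewrite !inE => /andP[_ /eqP pu] ->.
by apply: eq_bigr => u /eqP ->.
Qed.

Lemma integrable_simple_comp (U : choiceType) (h : T -> U) (phi : U -> V) :
  simple_map h ->
  (forall u, phi u != 0 -> (mu (h @^-1` [set u]) < +oo)%E) ->
  integrable_simple mu (phi \o h).
Proof.
move=> sh fin; split=> [|v v0]; first exact: (simple_map_comp phi sh).
have -> : (phi \o h) @^-1` [set v] =
    \bigcup_(u in range h `&` phi @^-1` [set v]) h @^-1` [set u].
  apply/seteqP; split=> [x /= px|x [u [_ /= pu] /= hx]]; last by rewrite hx.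
  by exists (h x) => //; split=> //; exists x.
have fr : finite_set (range h `&` phi @^-1` [set v]).
  by apply: finite_setIl; case: sh.
rewrite measure_fin_bigcup//; last 2 first.
- exact: trivIset_preimage1.
- by move=> u _; exact: sh.2.
rewrite fsbig_finite// big_seq; apply: lte_sum_pinfty => u.
by rewrite in_fset_set// inE => -[_ /= pu]; apply: fin; rewrite pu.
Qed.

Lemma fiber_sumB (U : choiceType) (h : T -> U) (phi psi : U -> V) :
  fiber_sum h (fun u => phi u - psi u) = fiber_sum h phi - fiber_sum h psi.
Proof.
rewrite /fiber_sum -sumrB; apply: eq_bigr => u _; by rewrite scalerBr.
Qed.

Lemma rnorm_fiber_sum (U : choiceType) (h : T -> U) (phi : U -> V) :
  simple_map h ->
  ((rnorm (fiber_sum h phi))%:E <= \int[mu]_x (rnorm (phi (h x)))%:E)%E.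
Proof.
move=> sh; rewrite (@integral_simple_map _ _ _ _ _ _ (rnorm \o phi))//; last first.
  by move=> u; exact: rnorm_ge0.
apply: (@le_trans _ _ (\sum_(u <- values h)
    (fine (mu (h @^-1` [set u])) * rnorm (phi u))%:E)%E).
  rewrite sumEFin lee_fin; apply: le_trans (rnorm_sum _ _ _) _.
  by apply: ler_sum => u _; rewrite rnormZr ger0_norm.
apply: lee_sum => u _.
rewrite EFinM muleC /=.
have [->|p0] := eqVneq (rnorm (phi u)) 0; first by rewrite !mul0e.
have pgt0 : (0 < (rnorm (phi u))%:E)%E by rewrite lte_fin lt_neqAle eq_sym p0 rnorm_ge0.
rewrite /= lee_wpmul2l// ?(ltW pgt0)//.
have : (0 <= mu (h @^-1` [set u]))%E by exact: measure_ge0.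
by case: (mu _) => [r _|_|//]; rewrite /= ?leey.
Qed.

Lemma integrable_simpleW (s : T -> V) : integrable_simple mu s -> simple_map s.
Proof. by case. Qed.

Lemma integrable_simple_pair (W : completeNormedModType R[i])
    (s : T -> V) (t : T -> W) :
  integrable_simple mu s -> integrable_simple mu t ->
  forall u, u != 0 -> (mu ((fun x => (s x, t x)) @^-1` [set u]) < +oo)%E.
Proof.
move=> [ss fs] [st ft] [v w]; rewrite xpair_eqE negb_and => /orP[v0|w0].
  apply: le_lt_trans (fs _ v0); apply: le_measure; rewrite ?inE//.
  - exact: (simple_map_pair ss st).2.
  - exact: ss.2.
  - by move=> x /= [-> _].
apply: le_lt_trans (ft _ w0); apply: le_measure; rewrite ?inE//.
- exact: (simple_map_pair ss st).2.
- exact: st.2.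
- by move=> x /= [_ ->].
Qed.

(** Both integrals are sums over the fibers of the pair [(s, t)]. *)
Lemma rnorm_simple_integralB (s t : T -> V) :
  integrable_simple mu s -> integrable_simple mu t ->
  ((rnorm (simple_integral mu s - simple_integral mu t))%:E <=
   \int[mu]_x (rnorm (s x - t x))%:E)%E.
Proof.
move=> is_ it.
pose h x := (s x, t x).
have sh : simple_map h by apply: simple_map_pair; exact: integrable_simpleW.
have fin := integrable_simple_pair is_ it.
have -> : simple_integral mu s = fiber_sum h fst.
  rewrite -(simple_integral_comp sh)// => u u0; apply: fin.
  by apply: contraNneq u0 => ->.
have -> : simple_integral mu t = fiber_sum h snd.
  rewrite -(simple_integral_comp sh)// => u u0; apply: fin.
  by apply: contraNneq u0 => ->.
rewrite -fiber_sumB; exact: (rnorm_fiber_sum (fun u => u.1 - u.2) sh).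
Qed.

Lemma integrable_simple0 : integrable_simple mu (fun=> 0 : V).
Proof.
split; first split.
- apply: (@sub_finite_set _ _ [set 0]) => // _ [x _ <-] //.
- by move=> v; rewrite preimage_cst; case: ifP.
- move=> v v0; rewrite preimage_cst ifF ?measure0// memNset//= => v0'.
  by rewrite -v0' eqxx in v0.
Qed.

Lemma simple_integral0 : simple_integral mu (fun=> 0 : V) = 0.
Proof. by rewrite /simple_integral fsbig1// => v [x _ <-]; rewrite scaler0. Qed.

Lemma rnorm_simple_integral (s : T -> V) : integrable_simple mu s ->
  ((rnorm (simple_integral mu s))%:E <= \int[mu]_x (rnorm (s x))%:E)%E.
Proof.
move=> is_; have := rnorm_simple_integralB is_ integrable_simple0.
rewrite simple_integral0 subr0.
by under eq_integral do rewrite subr0.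
Qed.

Lemma integral_rnorm_simple_fin (s : T -> V) : integrable_simple mu s ->
  (\int[mu]_x (rnorm (s x))%:E < +oo)%E.
Proof.
move=> [ss fs]; rewrite (integral_simple_map mu ss (@rnorm_ge0 _ _)).
apply: lte_sum_pinfty => u _.
have [->|u0] := eqVneq u 0; first by rewrite rnorm0 mul0e.
by rewrite lte_mul_pinfty ?lee_fin ?rnorm_ge0//; exact: fs.
Qed.

End SimpleIntegral.

(** * Bochner integrals *)

Section StronglyMeasurable.
Context {d : measure_display} {T : measurableType d} {R : realType}.

Lemma simple_strongly_measurable (V : completeNormedModType R[i]) (s : T -> V) :
  simple_map s -> strongly_measurable s.
Proof. by move=> ss; exists (fun=> s); split=> // x; exact: cvg_cst. Qed.

Lemma strongly_measurable_comp2 (V1 V2 W : completeNormedModType R[i])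
    (phi : V1 -> V2 -> W) (f : T -> V1) (g : T -> V2) :
  (forall (u : nat -> V1) (v : nat -> V2) x y, u @ \oo --> x -> v @ \oo --> y ->
     phi (u n) (v n) @[n --> \oo] --> phi x y) ->
  strongly_measurable f -> strongly_measurable g ->
  strongly_measurable (fun x => phi (f x) (g x)).
Proof.
move=> cphi [s [ss sf]] [t [st tg]].
exists (fun n x => phi (s n x) (t n x)); split=> [n|x]; last exact: cphi.
exact: (simple_map_comp (fun u => phi u.1 u.2) (simple_map_pair (ss n) (st n))).
Qed.

Lemma strongly_measurableB (V : completeNormedModType R[i]) (f g : T -> V) :
  strongly_measurable f -> strongly_measurable g ->
  strongly_measurable (fun x => f x - g x).
Proof.
apply: (strongly_measurable_comp2 (phi := fun x y => x - y)) => u v x y ux vy.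
exact: cvgB.
Qed.

Lemma strongly_measurable_rnorm (V : completeNormedModType R[i]) (f : T -> V) :
  strongly_measurable f -> measurable_fun setT (fun x => (rnorm (f x))%:E).
Proof.
move=> [s [ss sf]]; apply/measurable_EFinP.
apply: (measurable_fun_cvg (h := fun n x => rnorm (s n x))).
  by move=> n; apply: simple_map_measurable; exact: (simple_map_comp (@rnorm R V) (ss n)).
by move=> x _; apply: cvg_rnormr; exact: sf.
Qed.

End StronglyMeasurable.

Section ErealCvg0.
Context {R : realType}.

Lemma cvge0_le (e : nat -> \bar R) : e @ \oo --> 0%E ->
  forall c : R, 0 < c -> \forall n \near \oo, (e n <= c%:E)%E.
Proof.
move=> /fine_cvgP[fin /cvgr0Pnorm_le e0] c c0.
near=> n.
have fn : e n \is a fin_num by near: n.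
rewrite -(fineK fn) lee_fin (le_trans (ler_norm _))//.
by near: n; exact: e0.
Unshelve. all: by end_near. Qed.

Lemma cvge0_ge0 (e : nat -> \bar R) : (forall n, (0 <= e n)%E) ->
  (forall c : R, 0 < c -> \forall n \near \oo, (e n <= c%:E)%E) ->
  e @ \oo --> 0%E.
Proof.
move=> e0 h; apply/fine_cvgP; split.
  have := h 1 ltr01; apply: filterS => n en.
  by rewrite ge0_fin_numE// (le_lt_trans en)// ltry.
apply/cvgr0Pnorm_le => c c0; have := h c c0; apply: filterS => n en /=.
rewrite ger0_norm ?fine_ge0// -lee_fin fineK//.
by rewrite ge0_fin_numE// (le_lt_trans en)// ltry.
Qed.

End ErealCvg0.

Section BochnerIntegral.
Context {d : measure_display} {T : measurableType d} {R : realType}.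
Context {V : completeNormedModType R[i]}.
Variable mu : {measure set T -> \bar R}.
Implicit Types (f g h s : T -> V) (I J : V).

Lemma integral_rnorm_triangle f g h :
  strongly_measurable f -> strongly_measurable g -> strongly_measurable h ->
  (\int[mu]_x (rnorm (f x - h x))%:E <=
   \int[mu]_x (rnorm (f x - g x))%:E + \int[mu]_x (rnorm (g x - h x))%:E)%E.
Proof.
move=> mf mg mh.
have mfh := strongly_measurable_rnorm (strongly_measurableB mf mh).
have mfg := strongly_measurable_rnorm (strongly_measurableB mf mg).
have mgh := strongly_measurable_rnorm (strongly_measurableB mg mh).
rewrite -ge0_integralD//; try by move=> x _; rewrite lee_fin rnorm_ge0.
apply: ge0_le_integral => //.
- by move=> x _; rewrite lee_fin rnorm_ge0.
- exact: emeasurable_funD.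
- by move=> x _; rewrite -EFinD lee_fin rnormB.
Qed.

(** Two approximating sequences of simple functions are close in mean, hence so
    are their integrals. *)
Lemma bochner_unique f I J :
  is_bochner_integral mu f I -> is_bochner_integral mu f J -> I = J.
Proof.
move=> [mf [s [si s0 sI]]] [_ [t [ti t0 tJ]]].
apply/eqP; rewrite -subr_eq0 -rnorm_le0; apply/ler_addgt0Pr => c c0.
rewrite add0r.
have c2 : 0 < c / 2 by rewrite divr_gt0.
have st : simple_integral mu (s n) - simple_integral mu (t n) @[n --> \oo] --> I - J.
  exact: cvgB.
rewrite -[I - J]subr0; apply: (rnorm_lim_le st).
near=> n; rewrite subr0 -lee_fin.
apply: (le_trans (rnorm_simple_integralB (si n) (ti n))).
have ms := simple_strongly_measurable (integrable_simpleW (si n)).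
have mt := simple_strongly_measurable (integrable_simpleW (ti n)).
apply: (le_trans (integral_rnorm_triangle ms mf mt)).
rewrite [c]splitr EFinD leeD//.
  under eq_integral do rewrite rnormBC.
  by near: n; exact: cvge0_le s0 _ c2.
by near: n; exact: cvge0_le t0 _ c2.
Unshelve. all: by end_near. Qed.

Lemma integral_rnorm_simple_le f s :
  strongly_measurable f -> strongly_measurable s ->
  (\int[mu]_x (rnorm (s x))%:E <=
   \int[mu]_x (rnorm (f x))%:E + \int[mu]_x (rnorm (f x - s x))%:E)%E.
Proof.
move=> mf ms.
have m0 : strongly_measurable (fun _ : T => 0 : V).
  by apply: simple_strongly_measurable; case: (integrable_simple0 (V := V) mu).
have := integral_rnorm_triangle ms mf m0.
under eq_integral do rewrite subr0.
under [X in (_ <= _ + X)%E]eq_integral do rewrite subr0.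
under [X in (_ <= X + _)%E]eq_integral do rewrite rnormBC.
by rewrite addeC.
Qed.

Lemma bochner_integrable f I : is_bochner_integral mu f I ->
  (\int[mu]_x (rnorm (f x))%:E < +oo)%E.
Proof.
move=> [mf [s [si s0 _]]].
have [N _ /(_ _ (leqnn N)) sN] := cvge0_le s0 ltr01.
have ms := simple_strongly_measurable (integrable_simpleW (si N)).
apply: (le_lt_trans (integral_rnorm_simple_le ms mf)).
apply: lte_add_pinfty; first exact: integral_rnorm_simple_fin.
under eq_integral do rewrite rnormBC.
by rewrite (le_lt_trans sN)// ltry.
Qed.

Lemma rnorm_bochner f I : is_bochner_integral mu f I ->
  ((rnorm I)%:E <= \int[mu]_x (rnorm (f x))%:E)%E.
Proof.
move=> bf; have := bochner_integrable bf; case: bf => mf [s [si s0 sI]].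
set N := (\int[mu]_x _)%E => Nfin.
have N0 : (0 <= N)%E by apply: integral_ge0 => x _; rewrite lee_fin rnorm_ge0.
have NE : N = (fine N)%:E by rewrite fineK// ge0_fin_numE.
rewrite NE lee_fin; apply/ler_addgt0Pr => c c0.
rewrite -[I]subr0; apply: (rnorm_lim_le sI).
near=> n; rewrite subr0 -lee_fin.
apply: (le_trans (rnorm_simple_integral (si n))).
have ms := simple_strongly_measurable (integrable_simpleW (si n)).
apply: (le_trans (integral_rnorm_simple_le mf ms)).
rewrite -/N EFinD -NE leeD//.
by near: n; exact: cvge0_le s0 _ c0.
Unshelve. all: by end_near. Qed.

End BochnerIntegral.

Section BochnerLinear.
Context {d : measure_display} {T : measurableType d} {R : realType}.
Context {V W : completeNormedModType R[i]}.
Variables (mu : {measure set T -> \bar R}) (L : V -> W) (K : R).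
Hypothesis LD : forall x y, L (x + y) = L x + L y.
Hypothesis LZ : forall (k : R[i]) x, L (k *: x) = k *: L x.
Hypothesis K0 : 0 <= K.
Hypothesis LK : forall x, rnorm (L x) <= K * rnorm x.

Let L0 : L 0 = 0. Proof. by rewrite -(scale0r 0) LZ scale0r. Qed.

Let LB x y : L (x - y) = L x - L y.
Proof. by rewrite LD -scaleN1r LZ scaleN1r. Qed.

Lemma bounded_linear_cvg (u : nat -> V) x :
  u @ \oo --> x -> L (u n) @[n --> \oo] --> L x.
Proof.
move=> /cvg_rnorm ux; apply: (@rnorm_squeeze _ _ _ _ _ _ _ (fun n => K * rnorm (u n - x))).
  by move=> n; rewrite -LB.
by rewrite -[X in _ --> X](mulr0 K); exact: cvgMr.
Qed.

Lemma strongly_measurable_linear (f : T -> V) :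
  strongly_measurable f -> strongly_measurable (L \o f).
Proof.
move=> [s [ss sf]]; exists (fun n => L \o s n); split=> [n|x].
  exact: (simple_map_comp L (ss n)).
by apply: bounded_linear_cvg; exact: sf.
Qed.

Lemma bochner_linear (f : T -> V) I :
  is_bochner_integral mu f I -> is_bochner_integral mu (L \o f) (L I).
Proof.
move=> [mf [s [si s0 sI]]].
have mLf := strongly_measurable_linear mf.
have fin n u : L u != 0 -> (mu (s n @^-1` [set u]) < +oo)%E.
  by move=> Lu; apply: (si n).2; apply: contraNneq Lu => ->; rewrite L0.
have siL n : integrable_simple mu (L \o s n).
  exact: (integrable_simple_comp (integrable_simpleW (si n)) (fin n)).
split=> //; exists (fun n => L \o s n); split=> //.
  apply: cvge0_ge0 => [n|c c0].
    by apply: integral_ge0 => x _; rewrite lee_fin rnorm_ge0.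
  have c1 : 0 < c / (K + 1) by rewrite divr_gt0// ltr_wpDl.
  have := cvge0_le s0 c1; apply: filterS => n sn.
  have ms := simple_strongly_measurable (integrable_simpleW (si n)).
  have mfs := strongly_measurable_rnorm (strongly_measurableB mf ms).
  have mLs := simple_strongly_measurable (integrable_simpleW (siL n)).
  have mLfs := strongly_measurable_rnorm (strongly_measurableB mLf mLs).
  apply: (@le_trans _ _ (\int[mu]_x (K%:E * (rnorm (f x - s n x))%:E))%E).
    apply: ge0_le_integral => //.
    - by move=> x _; rewrite lee_fin rnorm_ge0.
    - by apply/measurable_EFinP; apply: measurable_funM => //; apply/measurable_EFinP.
    - move=> x _; rewrite -EFinM lee_fin /= -LB; exact: LK.
  rewrite ge0_integralZl_EFin//; last by move=> x _; rewrite lee_fin rnorm_ge0.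
  apply: (@le_trans _ _ (K%:E * (c / (K + 1))%:E)%E).
    by apply: lee_wpmul2l; rewrite ?lee_fin.
  have K1 : 0 < K + 1 by rewrite ltr_wpDl.
  by rewrite -EFinM lee_fin mulrCA ger_pMr// ler_pdivrMr// mul1r lerDl.
have SIL n : simple_integral mu (L \o s n) = L (simple_integral mu (s n)).
  rewrite (simple_integral_comp (integrable_simpleW (si n)) (fin n)).
  rewrite -[s n in RHS]/(id \o s n).
  rewrite (simple_integral_comp (integrable_simpleW (si n)) (si n).2).
  rewrite /fiber_sum (big_morph L LD L0).
  by apply: eq_bigr => u _; rewrite LZ.
have := bounded_linear_cvg sI.
by have -> : (fun n => L (simple_integral mu (s n))) =
    (fun n => simple_integral mu (L \o s n)) by apply/funext => n; rewrite SIL.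
Qed.

End BochnerLinear.

(** * Bilinear maps and product measures *)

Record contractive_bilinear (R : realType) (V1 V2 W : completeNormedModType R[i])
    (phi : V1 -> V2 -> W) : Prop := ContractiveBilinear {
  bilinDl : forall x x' y, phi (x + x') y = phi x y + phi x' y;
  bilinDr : forall x y y', phi x (y + y') = phi x y + phi x y';
  bilinZl : forall (k : R[i]) x y, phi (k *: x) y = k *: phi x y;
  bilinZr : forall (k : R[i]) x y, phi x (k *: y) = k *: phi x y;
  rnorm_bilin : forall x y, rnorm (phi x y) <= rnorm x * rnorm y
}.

Section Bilinear.
Context {R : realType} {V1 V2 W : completeNormedModType R[i]}.
Context {phi : V1 -> V2 -> W} (phiP : contractive_bilinear phi).

Lemma bilin0l y : phi 0 y = 0.
Proof. by rewrite -(scale0r 0) (bilinZl phiP) scale0r. Qed.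

Lemma bilin0r x : phi x 0 = 0.
Proof. by rewrite -(scale0r 0) (bilinZr phiP) scale0r. Qed.

Lemma bilinBl x x' y : phi (x - x') y = phi x y - phi x' y.
Proof. by rewrite (bilinDl phiP) -scaleN1r (bilinZl phiP) scaleN1r. Qed.

Lemma bilinBr x y y' : phi x (y - y') = phi x y - phi x y'.
Proof. by rewrite (bilinDr phiP) -scaleN1r (bilinZr phiP) scaleN1r. Qed.

(** Here [x'] and [y'] occur only in the increments: estimates involve the norms
    of the limits [x], [y] and not those of the approximations [x'], [y']. *)
Lemma bilinBB x x' y y' : phi x y - phi x' y' =
  phi (x - x') y + phi x (y - y') - phi (x - x') (y - y').
Proof.
rewrite (bilinBl x x' (y - y')) opprB addrACA subrr addr0.
by rewrite bilinBl bilinBr subrKA.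
Qed.

Lemma bilin_suml (I : Type) (r : seq I) (F : I -> V1) y :
  phi (\sum_(i <- r) F i) y = \sum_(i <- r) phi (F i) y.
Proof.
by rewrite (big_morph (phi^~ y) (fun a b => bilinDl phiP a b y) (bilin0l y)).
Qed.

Lemma bilin_sumr (I : Type) (r : seq I) (F : I -> V2) x :
  phi x (\sum_(i <- r) F i) = \sum_(i <- r) phi x (F i).
Proof. by rewrite (big_morph (phi x) (bilinDr phiP x) (bilin0r x)). Qed.

Lemma rnorm_bilinBB x x' y y' : rnorm (phi x y - phi x' y') <=
  rnorm (x - x') * rnorm y + rnorm x * rnorm (y - y')
  + rnorm (x - x') * rnorm (y - y').
Proof.
rewrite bilinBB (le_trans (rnormD _ _))// lerD ?rnormN ?(rnorm_bilin phiP)//.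
by rewrite (le_trans (rnormD _ _))// lerD// (rnorm_bilin phiP).
Qed.

Lemma bilin_cvg (u : nat -> V1) (v : nat -> V2) x y :
  u @ \oo --> x -> v @ \oo --> y -> phi (u n) (v n) @[n --> \oo] --> phi x y.
Proof.
move=> ux vy; apply/cvg_rnorm.
have u0 : rnorm (x - u n) @[n --> \oo] --> (0 : R).
  by move/cvg_rnorm: ux; under eq_fun do rewrite rnormBC.
have v0 : rnorm (y - v n) @[n --> \oo] --> (0 : R).
  by move/cvg_rnorm: vy; under eq_fun do rewrite rnormBC.
have e0 : rnorm (x - u n) * rnorm y + rnorm x * rnorm (y - v n)
    + rnorm (x - u n) * rnorm (y - v n) @[n --> \oo] --> (0 : R).
  rewrite (_ : 0 = 0 * rnorm y + rnorm x * 0 + 0 * 0); last by rewrite !mulr0 mul0r !addr0.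
  apply: cvgD; last exact: cvgM.
  by apply: cvgD; [exact: cvgMl|exact: cvgMr].
apply: (squeeze_cvgr _ (cvg_cst 0) e0).
by apply: nearW => n; rewrite rnorm_ge0 rnormBC rnorm_bilinBB.
Qed.

End Bilinear.

Section ProductMeasure.
Context {d1 d2 : measure_display} {T1 : measurableType d1} {T2 : measurableType d2}.

Lemma simple_map_fst (U : Type) (h : T1 -> U) :
  simple_map h -> simple_map (fun w : T1 * T2 => h w.1).
Proof.
move=> [fh mh]; split.
  by apply: sub_finite_set fh => _ [w _ <-]; exists w.1.
move=> u; have -> : (fun w : T1 * T2 => h w.1) @^-1` [set u] = (h @^-1` [set u]) `*` setT.
  by apply/seteqP; split=> w /= => [|[]].
exact: measurableX.
Qed.

Lemma simple_map_snd (U : Type) (h : T2 -> U) :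
  simple_map h -> simple_map (fun w : T1 * T2 => h w.2).
Proof.
move=> [fh mh]; split.
  by apply: sub_finite_set fh => _ [w _ <-]; exists w.2.
move=> u; have -> : (fun w : T1 * T2 => h w.2) @^-1` [set u] = setT `*` (h @^-1` [set u]).
  by apply/seteqP; split=> w /= => [|[]].
exact: measurableX.
Qed.

Lemma simple_map_prod (U1 U2 : Type) (h1 : T1 -> U1) (h2 : T2 -> U2) :
  simple_map h1 -> simple_map h2 ->
  simple_map (fun w : T1 * T2 => (h1 w.1, h2 w.2)).
Proof.
by move=> s1 s2; apply: simple_map_pair; [exact: simple_map_fst|exact: simple_map_snd].
Qed.

Lemma big_values_prod (Z : Type) (idx : Z) (op : Monoid.com_law idx)
    (U1 U2 : choiceType) (h1 : T1 -> U1) (h2 : T2 -> U2) (F : U1 * U2 -> Z) :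
  simple_map h1 -> simple_map h2 ->
  \big[op/idx]_(u <- values (fun w : T1 * T2 => (h1 w.1, h2 w.2))) F u =
  \big[op/idx]_(u <- values h1) \big[op/idx]_(v <- values h2) F (u, v).
Proof.
move=> [f1 _] [f2 _].
have rE : range (fun w : T1 * T2 => (h1 w.1, h2 w.2)) = range h1 `*` range h2.
  apply/seteqP; split=> [_ [w _ <-]|[u v] [/= [x _ <-] [y _ <-]]].
    by split; [exists w.1|exists w.2].
  by exists (x, y).
rewrite /values rE -fsbig_finite; last exact: finite_setX.
rewrite -fsbig_finite//; under [RHS]eq_fsbigr do rewrite -fsbig_finite//.
by rewrite pair_fsbig//; apply: eq_fsbigr => -[].
Qed.

Lemma strongly_measurable_fst (R : realType) (V : completeNormedModType R[i]) (f : T1 -> V) :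
  strongly_measurable f -> strongly_measurable (fun w : T1 * T2 => f w.1).
Proof.
move=> [s [ss sf]]; exists (fun n w => s n w.1); split=> [n|w]; last exact: sf.
exact: (simple_map_fst (ss n)).
Qed.

Lemma strongly_measurable_snd (R : realType) (V : completeNormedModType R[i]) (f : T2 -> V) :
  strongly_measurable f -> strongly_measurable (fun w : T1 * T2 => f w.2).
Proof.
move=> [s [ss sf]]; exists (fun n w => s n w.2); split=> [n|w]; last exact: sf.
exact: (simple_map_snd (ss n)).
Qed.

Section Integral.
Context {R : realType}.
Variables (mu1 : {measure set T1 -> \bar R}) (mu2 : {measure set T2 -> \bar R}).
Variable mu : {measure set (T1 * T2) -> \bar R}.
Hypothesis muP : is_product_measure mu1 mu2 mu.

Lemma measure_fiber_prod (U1 U2 : Type) (h1 : T1 -> U1) (h2 : T2 -> U2) u v :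
  simple_map h1 -> simple_map h2 ->
  (mu ((fun w : T1 * T2 => (h1 w.1, h2 w.2)) @^-1` [set (u, v)]) =
   mu1 (h1 @^-1` [set u]) * mu2 (h2 @^-1` [set v]))%E.
Proof.
move=> s1 s2; rewrite -muP; [|exact: s1.2|exact: s2.2].
by congr (mu _); apply/seteqP; split=> w /= [-> ->].
Qed.

Lemma integral_prod_simple (a : T1 -> R) (b : T2 -> R) :
  simple_map a -> simple_map b -> (forall x, 0 <= a x) -> (forall y, 0 <= b y) ->
  (\int[mu]_w (a w.1 * b w.2)%:E = (\int[mu1]_x (a x)%:E) * \int[mu2]_y (b y)%:E)%E.
Proof.
move=> sa sb a0 b0.
transitivity (\int[mu]_w (`|a w.1| * `|b w.2|)%:E)%E.
  by apply: eq_integral => w _; rewrite !ger0_norm.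
have -> : (\int[mu1]_x (a x)%:E = \int[mu1]_x (`|a x|)%:E)%E.
  by apply: eq_integral => w _; rewrite ger0_norm.
have -> : (\int[mu2]_x (b x)%:E = \int[mu2]_x (`|b x|)%:E)%E.
  by apply: eq_integral => w _; rewrite ger0_norm.
rewrite (integral_simple_map mu1 (phi := fun u => `|u|) sa)//.
rewrite (integral_simple_map mu2 (phi := fun u => `|u|) sb)//.
rewrite (integral_simple_map mu (h := fun w => (a w.1, b w.2))
  (phi := fun u => `|u.1| * `|u.2|) (simple_map_prod sa sb)); last first.
  by move=> u; rewrite mulr_ge0.
rewrite big_values_prod// ge0_sume_distrl; last by move=> u _; rewrite mule_ge0.
apply: eq_bigr => u _; rewrite ge0_sume_distrr; last by move=> v _; rewrite mule_ge0.
by apply: eq_bigr => v _; rewrite measure_fiber_prod// EFinM muleACA.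
Qed.

(** Increasing simple approximations of [a] and [b] reduce the formula to
    rectangles, the sets on which [mu] is given. *)
Lemma integral_prod (a : T1 -> R) (b : T2 -> R) :
  measurable_fun setT (EFin \o a) -> measurable_fun setT (EFin \o b) ->
  (forall x, 0 <= a x) -> (forall y, 0 <= b y) ->
  (\int[mu1]_x (a x)%:E < +oo)%E -> (\int[mu2]_y (b y)%:E < +oo)%E ->
  (\int[mu]_w (a w.1 * b w.2)%:E = (\int[mu1]_x (a x)%:E) * \int[mu2]_y (b y)%:E)%E.
Proof.
move=> ma mb a0 b0 afin bfin.
pose an := nnsfun_approx measurableT ma; pose bn := nnsfun_approx measurableT mb.
have simple d (T : measurableType d) (f : {nnsfun T >-> R}) : simple_map (f : T -> R).
  by split=> [|u]; [exact: fimfunP|apply: measurable_funPTI].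
have ndc d (T : measurableType d) (f : T -> \bar R) (mf : measurable_fun setT f) x :
    {homo (fun n => nnsfun_approx measurableT mf n x) : n m / (n <= m)%N >-> n <= m}.
  by move=> n m nm; exact: (lef_at x (nd_nnsfun_approx measurableT mf) nm).
have int_cvg d (T : measurableType d) (nu : {measure set T -> \bar R}) (f : T -> R)
    (mf : measurable_fun setT (EFin \o f)) : (forall x, 0 <= f x) ->
    (\int[nu]_x (nnsfun_approx measurableT mf n x)%:E)%E @[n --> \oo] -->
    (\int[nu]_x (f x)%:E)%E.
  move=> f0.
  rewrite (_ : (\int[nu]_x (f x)%:E)%E =
      \int[nu]_x (limn (fun n => (nnsfun_approx measurableT mf n x)%:E)))%E; last first.
    apply: eq_integral => x _; apply/esym/cvg_lim => //.
    by apply: (cvg_nnsfun_approx measurableT mf) => // y _; rewrite lee_fin.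
  apply: cvg_monotone_convergence => //.
  - by move=> n; apply/measurable_EFinP; exact: simple_map_measurable.
  - by move=> n x _; rewrite lee_fin.
  - by move=> x _ n m nm; rewrite lee_fin; exact: ndc.
have lim1 := int_cvg _ _ mu1 a ma a0; have lim2 := int_cvg _ _ mu2 b mb b0.
have fin1 : (\int[mu1]_x (a x)%:E)%E \is a fin_num.
  by rewrite ge0_fin_numE// integral_ge0// => x _; rewrite lee_fin.
have fin2 : (\int[mu2]_x (b x)%:E)%E \is a fin_num.
  by rewrite ge0_fin_numE// integral_ge0// => x _; rewrite lee_fin.
have lim12 := cvgeM (mule_def_fin fin1 fin2) lim1 lim2.
have prodE n : ((\int[mu1]_x (an n x)%:E) * (\int[mu2]_y (bn n y)%:E) =
    \int[mu]_w (an n w.1 * bn n w.2)%:E)%E.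
  by rewrite (integral_prod_simple (simple _ _ (an n)) (simple _ _ (bn n))).
have {}lim12 : (\int[mu]_w (an n w.1 * bn n w.2)%:E)%E @[n --> \oo] -->
    ((\int[mu1]_x (a x)%:E) * \int[mu2]_y (b y)%:E)%E.
  have <- : (fun n => (\int[mu1]_x (an n x)%:E) * (\int[mu2]_y (bn n y)%:E))%E =
      (fun n => \int[mu]_w (an n w.1 * bn n w.2)%:E)%E by apply/funext => n; exact: prodE.
  exact: lim12.
suff lim : (\int[mu]_w (an n w.1 * bn n w.2)%:E)%E @[n --> \oo] -->
    (\int[mu]_w (a w.1 * b w.2)%:E)%E.
  by rewrite -(cvg_lim _ lim12)// -(cvg_lim _ lim).
rewrite (_ : (\int[mu]_w (a w.1 * b w.2)%:E)%E =
    \int[mu]_w (limn (fun n => (an n w.1 * bn n w.2)%:E)))%E; last first.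
  apply: eq_integral => w _; apply/esym/cvg_lim => //.
  under eq_fun do rewrite EFinM; rewrite EFinM; apply: cvgeM => //.
  - by apply: (cvg_nnsfun_approx measurableT ma) => // y _; rewrite lee_fin.
  - by apply: (cvg_nnsfun_approx measurableT mb) => // y _; rewrite lee_fin.
apply: cvg_monotone_convergence => //.
- move=> n; apply/measurable_EFinP; apply: measurable_funM.
    by apply: simple_map_measurable; exact: simple_map_fst.
  by apply: simple_map_measurable; exact: simple_map_snd.
- by move=> n w _; rewrite lee_fin mulr_ge0.
- by move=> w _ n m nm; rewrite lee_fin ler_pM//; exact: ndc.
Qed.

Context {V1 V2 W : completeNormedModType R[i]}.
Context {phi : V1 -> V2 -> W} (phiP : contractive_bilinear phi).

Lemma simple_integral_bilin (s1 : T1 -> V1) (s2 : T2 -> V2) :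
  integrable_simple mu1 s1 -> integrable_simple mu2 s2 ->
  integrable_simple mu (fun w => phi (s1 w.1) (s2 w.2)) /\
  simple_integral mu (fun w => phi (s1 w.1) (s2 w.2)) =
    phi (simple_integral mu1 s1) (simple_integral mu2 s2).
Proof.
move=> i1 i2.
have sm1 := integrable_simpleW i1; have sm2 := integrable_simpleW i2.
pose h w := (s1 w.1, s2 w.2); pose g u := phi u.1 u.2.
have sh : simple_map h by exact: simple_map_prod.
have fin u : g u != 0 -> (mu (h @^-1` [set u]) < +oo)%E.
  case: u => u v g0; rewrite measure_fiber_prod//.
  have u0 : u != 0 by apply: contraNneq g0 => ->; rewrite /g bilin0l.
  have v0 : v != 0 by apply: contraNneq g0 => ->; rewrite /g bilin0r.
  by rewrite lte_mul_pinfty// ?ge0_fin_numE//; [exact: i1.2|exact: i2.2].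
split; first exact: (integrable_simple_comp sh fin).
rewrite (simple_integral_comp sh fin) /fiber_sum big_values_prod//.
rewrite -[s1 in RHS]/(id \o s1) -[s2 in RHS]/(id \o s2).
rewrite (simple_integral_comp sm1 i1.2) (simple_integral_comp sm2 i2.2) /fiber_sum.
rewrite (bilin_suml phiP); apply: eq_bigr => u _.
rewrite (bilin_sumr phiP); apply: eq_bigr => v _.
rewrite (bilinZl phiP) (bilinZr phiP) scalerA measure_fiber_prod//= /g/=.
have [->|u0] := eqVneq u 0; first by rewrite bilin0l// !scaler0.
have [->|v0] := eqVneq v 0; first by rewrite bilin0r// !scaler0.
rewrite fineM ?rmorphM// ge0_fin_numE//; [exact: i1.2|exact: i2.2].
Qed.

Lemma strongly_measurable_bilin (f1 : T1 -> V1) (f2 : T2 -> V2) :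
  strongly_measurable f1 -> strongly_measurable f2 ->
  strongly_measurable (fun w : T1 * T2 => phi (f1 w.1) (f2 w.2)).
Proof.
move=> m1 m2; apply: strongly_measurable_comp2.
- by move=> u v x y; exact: bilin_cvg.
- exact: strongly_measurable_fst.
- exact: strongly_measurable_snd.
Qed.

(** The integral of a product of simple functions is the product of the
    integrals, and the distance between the products is controlled by the
    distances between the factors. *)
Lemma bochner_bilin (f1 : T1 -> V1) (f2 : T2 -> V2) I1 I2 :
  is_bochner_integral mu1 f1 I1 -> is_bochner_integral mu2 f2 I2 ->
  is_bochner_integral mu (fun w => phi (f1 w.1) (f2 w.2)) (phi I1 I2).
Proof.
move=> b1 b2; have fin1 := bochner_integrable b1; have fin2 := bochner_integrable b2.
have [m1 [s1 [i1 e1 l1]]] := b1; have [m2 [s2 [i2 e2 l2]]] := b2.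
split; first exact: strongly_measurable_bilin.
exists (fun n w => phi (s1 n w.1) (s2 n w.2)); split; last 1 first.
- under eq_fun do rewrite (simple_integral_bilin (i1 _) (i2 _)).2.
  exact: bilin_cvg.
- by move=> n; exact: (simple_integral_bilin (i1 n) (i2 n)).1.
have rge0 d (T : measurableType d) (nu : {measure set T -> \bar R})
    (V : completeNormedModType R[i]) (f : T -> V) :
    (0 <= \int[nu]_x (rnorm (f x))%:E)%E.
  by apply: integral_ge0 => x _; rewrite lee_fin rnorm_ge0.
apply: cvge0_ge0 => [n|c c0].
  exact: (rge0 _ _ _ _ (fun w => phi (f1 w.1) (f2 w.2) - phi (s1 n w.1) (s2 n w.2))).
set N1 := (\int[mu1]_x _)%E in fin1; set N2 := (\int[mu2]_x _)%E in fin2.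
have N1E : N1 = (fine N1)%:E by rewrite fineK// ge0_fin_numE// rge0.
have N2E : N2 = (fine N2)%:E by rewrite fineK// ge0_fin_numE// rge0.
have r1 : 0 <= fine N1 by rewrite fine_ge0// rge0.
have r2 : 0 <= fine N2 by rewrite fine_ge0// rge0.
have den : 0 < fine N1 + fine N2 + 1 by rewrite ltr_wpDl// addr_ge0.
(* If both factors are within [k] in mean, the products are within
   [k N2 + N1 k + k ^ 2 <= k (N1 + N2 + 1)]. *)
pose k := Num.min 1 (c / (fine N1 + fine N2 + 1)).
have k0 : 0 < k by rewrite lt_min ltr01 divr_gt0.
near=> n.
have E1 : (\int[mu1]_x (rnorm (f1 x - s1 n x))%:E <= k%:E)%E.
  by near: n; exact: cvge0_le e1 _ k0.
have E2 : (\int[mu2]_x (rnorm (f2 x - s2 n x))%:E <= k%:E)%E.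
  by near: n; exact: cvge0_le e2 _ k0.
have ms1 := simple_strongly_measurable (integrable_simpleW (i1 n)).
have ms2 := simple_strongly_measurable (integrable_simpleW (i2 n)).
have mf1 := strongly_measurable_rnorm m1.
have mf2 := strongly_measurable_rnorm m2.
have md1 := strongly_measurable_rnorm (strongly_measurableB m1 ms1).
have md2 := strongly_measurable_rnorm (strongly_measurableB m2 ms2).
have F1 := le_lt_trans E1 (ltry k); have F2 := le_lt_trans E2 (ltry k).
pose g a b : T1 * T2 -> \bar R := fun w : T1 * T2 => ((a w.1 : R) * (b w.2 : R))%:E.
have mg (a : T1 -> R) (b : T2 -> R) : measurable_fun setT (EFin \o a) ->
    measurable_fun setT (EFin \o b) -> measurable_fun setT (g a b).
  move=> /measurable_EFinP ma /measurable_EFinP mb; apply/measurable_EFinP.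
  by apply: measurable_funM; apply: measurableT_comp.
pose a0 x := rnorm (f1 x); pose a1 x := rnorm (f1 x - s1 n x).
pose b0 y := rnorm (f2 y); pose b1' y := rnorm (f2 y - s2 n y).
apply: (@le_trans _ _ (\int[mu]_w (g a1 b0 w + g a0 b1' w + g a1 b1' w))%E).
  apply: ge0_le_integral => //.
  - by move=> w _; rewrite lee_fin rnorm_ge0.
  - apply: strongly_measurable_rnorm; apply: strongly_measurableB.
      exact: strongly_measurable_bilin.
    exact: strongly_measurable_bilin.
  - by apply: emeasurable_funD; [apply: emeasurable_funD|]; apply: mg.
  - by move=> w _; rewrite /g -!EFinD lee_fin; exact: rnorm_bilinBB.
have g0 a b w : (forall x, 0 <= a x) -> (forall y, 0 <= b y) -> (0 <= g a b w)%E.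
  by move=> ha hb; rewrite lee_fin mulr_ge0.
rewrite ge0_integralD//; last 4 first.
- by move=> w _; rewrite adde_ge0// g0// => x; exact: rnorm_ge0.
- by apply: emeasurable_funD; apply: mg.
- by move=> w _; rewrite g0// => x; exact: rnorm_ge0.
- by apply: mg.
rewrite ge0_integralD//; last 4 first.
- by move=> w _; rewrite g0// => x; exact: rnorm_ge0.
- by apply: mg.
- by move=> w _; rewrite g0// => x; exact: rnorm_ge0.
- by apply: mg.
rewrite /g !integral_prod//; try by move=> x; exact: rnorm_ge0.
rewrite -/N1 -/N2.
apply: (@le_trans _ _ (k%:E * N2 + N1 * k%:E + k%:E * k%:E)%E).
  apply: leeD; first apply: leeD.
  - by apply: lee_wpmul2r => //; exact: rge0.
  - by apply: lee_wpmul2l => //; exact: rge0.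
  - by apply: lee_pmul => //; exact: rge0.
rewrite N1E N2E -!EFinM -!EFinD lee_fin.
have k1 : k <= 1 by rewrite ge_min lexx.
have kc : k * (fine N1 + fine N2 + 1) <= c.
  by rewrite -ler_pdivlMr// ge_min lexx orbT.
nra.
Unshelve. all: by end_near. Qed.

End Integral.
End ProductMeasure.

(** * Inner products and a uniform boundedness principle *)

Section HilbertModule.
Context {R : realType} {A : cstarAlgebraType R} {H : hilbertModuleType A}.
Implicit Types (x y z : H) (a b : A) (k : R[i]).

Lemma ip0l y : ip 0 y = 0.
Proof. by apply: (addIr (ip 0 y)); rewrite -ipDl !add0r. Qed.

Lemma ipZl k x y : ip (k *: x) y = k *: ip x y.
Proof.
have -> : k *: x = act (k *: cone) x by rewrite actZ act1.
by rewrite ip_act cmulZl cmul1l.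
Qed.

Lemma ipNl x y : ip (- x) y = - ip x y.
Proof. by rewrite -scaleN1r ipZl scaleN1r. Qed.

Lemma ipBl x y z : ip (x - y) z = ip x z - ip y z.
Proof. by rewrite ipDl ipNl. Qed.

Lemma ipDr x y z : ip x (y + z) = ip x y + ip x z.
Proof. by rewrite -cstar_ip ipDl cstarD !cstar_ip. Qed.

Lemma ipNr x y : ip x (- y) = - ip x y.
Proof. by rewrite -cstar_ip ipNl cstarN cstar_ip. Qed.

Lemma ipBr x y z : ip x (y - z) = ip x y - ip x z.
Proof. by rewrite ipDr ipNr. Qed.

Lemma ipZr k x y : ip x (k *: y) = Num.conj k *: ip x y.
Proof. by rewrite -cstar_ip ipZl cstarZ cstar_ip. Qed.

Lemma ip_actr a x y : ip x (act a y) = ip x y ⋅ cstar a.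
Proof. by rewrite -cstar_ip ip_act cstarM cstar_ip. Qed.

Lemma rnorm_ip x : rnorm (ip x x) = rnorm x ^+ 2.
Proof. by apply: complexI; rewrite rmorphXn/= -!rnormE normr_ip. Qed.

Lemma ip_definite x : ip x x = 0 -> x = 0.
Proof.
move=> xx; apply/eqP; rewrite -rnorm_eq0.
by have := rnorm_ip x; rewrite xx rnorm0 => /esym/eqP; rewrite expf_eq0.
Qed.

Lemma rnorm_ip_sym x y :
  rnorm (ip x y + ip y x) <= 2 * (rnorm x + rnorm y) ^+ 2.
Proof.
have -> : ip x y + ip y x = ip (x + y) (x + y) - ip x x - ip y y.
  rewrite ipDl !ipDr (addrC (ip x x)) -!addrA; congr (_ + _).
  by rewrite [RHS]addrCA (addrCA (ip y y)) subrr addr0 subrr addr0.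
have h1 := rnormD (ip (x + y) (x + y) - ip x x) (- ip y y).
have h2 := rnormD (ip (x + y) (x + y)) (- ip x x).
rewrite !rnormN !rnorm_ip in h1 h2.
have h3 : rnorm (x + y) ^+ 2 <= (rnorm x + rnorm y) ^+ 2.
  by rewrite ler_sqr ?nnegrE ?addr_ge0 ?rnorm_ge0// rnormD.
have := rnorm_ge0 x; have := rnorm_ge0 y; nra.
Qed.

(** [2 <x, y>] is the sum of [<x, y> + <y, x>] and [- i (<i x, y> + <y, i x>)],
    and symmetric sums are differences of values [<z, z>]. *)
Lemma rnorm_ip_add x y : rnorm (ip x y) <= 2 * (rnorm x + rnorm y) ^+ 2.
Proof.
pose j : R[i] := 0 +i* 1.
have jj : j * j = -1 by exact: sqr_i.
have jc : Num.conj j = - j by rewrite conjCE /j /=; simpc.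
have jn : complex.Re `|j| = 1.
  by rewrite normc_def /= expr0n add0r expr1n sqrtr1.
have jx : rnorm (j *: x) = rnorm x by rewrite rnormZ jn mul1r.
have e : 2%:C *: ip x y = (ip x y + ip y x) - j *: (ip (j *: x) y + ip y (j *: x)).
  rewrite ipZl ipZr jc scalerDr !scalerA mulrN jj opprK scaleN1r scale1r.
  by rewrite opprD opprK addrACA subrr addr0 rmorphD/= scalerDl scale1r.
have h1 := rnorm_ip_sym x y; have h2 := rnorm_ip_sym (j *: x) y.
have := rnormD (ip x y + ip y x) (- (j *: (ip (j *: x) y + ip y (j *: x)))).
rewrite -e rnormZr ger0_norm// rnormN rnormZ jn mul1r; rewrite jx in h2; lra.
Qed.

(** A Cauchy-Schwarz inequality with a constant, which is all that continuity of
    the inner product requires. *)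
Lemma rnorm_ip_le x y : rnorm (ip x y) <= 8 * (rnorm x * rnorm y).
Proof.
have [->|x0] := eqVneq x 0; first by rewrite ip0l !rnorm0 mul0r mulr0.
have [->|y0] := eqVneq y 0.
  by rewrite -cstar_ip ip0l cstar0 !rnorm0 !mulr0.
have xp : 0 < rnorm x by rewrite lt_neqAle eq_sym rnorm_eq0 x0 rnorm_ge0.
have yp : 0 < rnorm y by rewrite lt_neqAle eq_sym rnorm_eq0 y0 rnorm_ge0.
have := rnorm_ip_add ((rnorm x)^-1%:C *: x) ((rnorm y)^-1%:C *: y).
rewrite ipZl ipZr conjCE conjc_real !rnormZr !ger0_norm ?invr_ge0 ?rnorm_ge0//.
rewrite !mulVf ?gt_eqF// => h.
have : (rnorm x)^-1 * ((rnorm y)^-1 * rnorm (ip x y)) <= 8 by apply: le_trans h _; lra.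
have -> : 8 * (rnorm x * rnorm y) = rnorm y * (rnorm x * 8) by ring.
by rewrite ler_pdivrMl// ler_pdivrMl.
Qed.

Lemma cvg_ipl (u : nat -> H) x y :
  u @ \oo --> x -> ip (u n) y @[n --> \oo] --> ip x y.
Proof.
move=> /cvg_rnorm ux; apply: (@rnorm_squeeze _ _ _ _ _ _ _
  (fun n => 8 * (rnorm (u n - x) * rnorm y))).
  by move=> n; rewrite -ipBl rnorm_ip_le.
rewrite (_ : 0 = 8 * (0 * rnorm y)); last by rewrite mul0r mulr0.
by apply: cvgMr; apply: cvgMl.
Qed.

Lemma cvg_ipr (u : nat -> H) x y :
  u @ \oo --> x -> ip y (u n) @[n --> \oo] --> ip y x.
Proof.
move=> ux; rewrite -cstar_ip; have := cvg_cstar (@cvg_ipl u x y ux).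
by under eq_fun do rewrite cstar_ip.
Qed.

End HilbertModule.

Section UniformBoundedness.
Context {R : realType} {V : completeNormedModType R[i]}.
Variable N : V -> \bar R.
Hypothesis N_closed : forall (u : nat -> V) l (c : R),
  u @ \oo --> l -> (forall n, N (u n) <= c%:E)%E -> (N l <= c%:E)%E.

Let open_gt (c : R) x : (c%:E < N x)%E ->
  exists2 r : R, 0 < r & forall y, rnorm (y - x) <= r -> (c%:E < N y)%E.
Proof.
move=> cx; apply: contrapT => no.
have bad n : exists y, rnorm (y - x) <= n.+1%:R^-1 /\ (N y <= c%:E)%E.
  apply: contrapT => none; apply: no; exists n.+1%:R^-1; first by rewrite invr_gt0.
  move=> y yx; rewrite ltNge; apply/negP => yc; apply: none; by exists y.
have [u uP] := choice bad.
have ux : u @ \oo --> x.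
  by apply: (rnorm_squeeze (e := harmonic)) => [n|]; [exact: (uP n).1|exact: cvg_harmonic].
have := N_closed ux (fun n => (uP n).2).
by rewrite leNgt cx.
Qed.

(** Baire's argument: otherwise nested balls on which [N > 0], [N > 1], ...
    shrink to a point where [N] is infinite. *)
Lemma locally_bounded : (forall x, N x < +oo)%E ->
  exists x (r c : R), 0 < r /\ forall y, rnorm (y - x) < r -> (N y <= c%:E)%E.
Proof.
move=> Nfin; apply: contrapT => none.
(* A ball of center [np.2.1] and radius [np.2.2] contains a smaller closed ball,
   of at most half the radius, on which [N > np.1]. *)
have step (np : nat * (V * R)) : exists q : V * R, 0 < np.2.2 ->
    [/\ 0 < q.2, q.2 <= np.2.2 / 2, rnorm (q.1 - np.2.1) <= np.2.2 / 2 &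
      forall y, rnorm (y - q.1) <= q.2 -> (np.1%:R%:E < N y)%E].
  case: np => n [x r] /=; have [r0|] := ltP 0 r; last by exists (x, r) => //; lra.
  have [y [yx ny]] : exists y, rnorm (y - x) < r / 2 /\ (n%:R%:E < N y)%E.
    apply: contrapT => noy; apply: none; exists x, (r / 2), n%:R; split.
      by rewrite divr_gt0.
    by move=> y yx; rewrite leNgt; apply/negP => ny; apply: noy; exists y.
  have [r' r'0 r'P] := open_gt ny.
  exists (y, Num.min r' (r / 2)) => _ /=; split.
  - by rewrite lt_min r'0 divr_gt0.
  - by rewrite ge_min lexx orbT.
  - exact: ltW.
  - by move=> z zy; apply: r'P; rewrite (le_trans zy)// ge_min lexx.
have [next nextP] := choice step.
pose s := fix s n := if n is m.+1 then next (m, s m) else (0 : V, 1 : R).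
have sr n : 0 < (s n).2.
  by elim: n => //= n ih; have [] := nextP (n, s n) ih.
have half n : (s n.+1).2 <= (s n).2 / 2 by have [] := nextP (n, s n) (sr n).
have move_ n : rnorm ((s n.+1).1 - (s n).1) <= (s n).2 / 2.
  by have [] := nextP (n, s n) (sr n).
have big n y : rnorm (y - (s n.+1).1) <= (s n.+1).2 -> (n%:R%:E < N y)%E.
  by have [_ _ _] := nextP (n, s n) (sr n); apply.
have sd n k : (s (n + k)%N).2 <= (s n).2 * 2^-1 ^+ k.
  elim: k => [|k ih]; first by rewrite addn0 expr0 mulr1.
  rewrite addnS exprSr mulrA (le_trans (half _))// ler_wpM2r//.
(* The later centers stay within [r_n / 2 + r_n / 4 + ... = r_n] of the n-th. *)
have lim n : exists l, (fun k => (s (n + k)%N).1) @ \oo --> l /\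
    rnorm (l - (s n).1) <= (s n).2.
  have [||l [ul dist]] := @geometric_steps_cvg _ _ (fun k => (s (n + k)%N).1)
    ((s n).2 / 2) 2^-1.
  - by rewrite invr_ge0 ler0n invf_lt1// ltr1n.
  - move=> k; rewrite addnS (le_trans (move_ _))// mulrAC ler_wpM2r//.
  exists l; split=> //; have := dist 0%N; rewrite addn0 expr0 mulr1.
  have -> : 1 - 2^-1 = 2^-1 :> R by lra.
  by rewrite invrK divfK.
have [l [ul _]] := lim 0%N.
have near_l n : rnorm (l - (s n).1) <= (s n).2.
  have [l' [ul' d']] := lim n.
  suff -> : l = l' by [].
  apply: cvg_unique_seq ul'.
  have := ul; rewrite -(cvg_shiftn n); under eq_fun do rewrite add0n addnC.
  by [].
have Nl := Nfin l.
have gtn n : (n%:R%:E < N l)%E by exact: big (near_l n.+1).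
have Nl0 : (0 <= N l)%E := ltW (gtn 0%N).
have NlE : N l = (fine (N l))%:E by rewrite fineK// ge0_fin_numE.
have := gtn (Num.bound (fine (N l))); rewrite NlE lte_fin.
by apply/negP; rewrite -leNgt ltW// archi_boundP// fine_ge0.
Qed.

End UniformBoundedness.

(** * Two-sided bounds for the form of a biframe *)

Section LinearityOfIntegral.
Context {R : realType} {A : cstarAlgebraType R}.

Lemma cmul_bilinear : contractive_bilinear (@cmul R A).
Proof.
split.
- exact: cmulDl.
- exact: cmulDr.
- exact: cmulZl.
- exact: cmulZr.
- exact: rnorm_cmul.
Qed.

(** The integral of the commutator with [b] is the commutator of the integral. *)
Lemma bochner_comm d (T : measurableType d) (mu : {measure set T -> \bar R})
    (f : T -> A) (I b : A) :
  (forall w, f w ⋅ b = b ⋅ f w) -> is_bochner_integral mu f I -> I ⋅ b = b ⋅ I.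
Proof.
move=> fb bI; pose L z := z ⋅ b - b ⋅ z.
have LD x y : L (x + y) = L x + L y.
  by rewrite /L cmulDl cmulDr opprD addrACA.
have LZ (k : R[i]) x : L (k *: x) = k *: L x.
  by rewrite /L cmulZl cmulZr scalerBr.
have LK x : rnorm (L x) <= (2 * rnorm b) * rnorm x.
  have := rnorm_cmul x b; have := rnorm_cmul b x.
  have := rnormD (x ⋅ b) (- (b ⋅ x)); rewrite rnormN /L; lra.
have K0 : 0 <= 2 * rnorm b by rewrite mulr_ge0// rnorm_ge0.
have := rnorm_bochner (bochner_linear LD LZ K0 LK bI).
rewrite (_ : (\int[mu]_x _)%E = 0%E).
  by rewrite lee_fin rnorm_le0 subr_eq0 => /eqP.
by apply: integral0_eq => w _; rewrite /= /L fb subrr rnorm0.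
Qed.

Lemma bochner_conj d (T : measurableType d) (mu : {measure set T -> \bar R})
    (f : T -> A) (I a : A) : is_bochner_integral mu f I ->
  is_bochner_integral mu (fun w => a ⋅ f w ⋅ cstar a) (a ⋅ I ⋅ cstar a).
Proof.
apply: (bochner_linear (L := fun z => a ⋅ z ⋅ cstar a) (K := rnorm a * rnorm a)).
- by move=> x y; rewrite cmulDr cmulDl.
- by move=> k x; rewrite cmulZr cmulZl.
- by rewrite mulr_ge0 ?rnorm_ge0.
- move=> x; rewrite (le_trans (rnorm_cmul _ _))// rnorm_cstar mulrAC.
  by rewrite ler_wpM2r ?rnorm_ge0// rnorm_cmul.
Qed.

End LinearityOfIntegral.

Section FormBound.
Context {d : measure_display} {T : measurableType d} {R : realType}.
Context {A : cstarAlgebraType R} {H : hilbertModuleType A}.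
Variables (mu : {measure set T -> \bar R}) (X Y : T -> H).

Definition biframe_integrand (f : H) (w : T) : A := ip f (X w) ⋅ ip (Y w) f.

Local Notation F := biframe_integrand.

Hypothesis F_integrable : forall f, exists I, is_bochner_integral mu (F f) I.

Let N f := (\int[mu]_w (rnorm (F f w))%:E)%E.

Let F_meas f : strongly_measurable (F f).
Proof. by have [I []] := F_integrable f. Qed.

Let N_fin f : (N f < +oo)%E.
Proof. by have [I bI] := F_integrable f; exact: bochner_integrable bI. Qed.

Let N_ge0 f : (0 <= N f)%E.
Proof. by apply: integral_ge0 => w _; rewrite lee_fin rnorm_ge0. Qed.

Let cvg_F (u : nat -> H) l w : u @ \oo --> l -> F (u n) w @[n --> \oo] --> F l w.
Proof. by move=> ul; apply: cvg_cmul; [exact: cvg_ipl|exact: cvg_ipr]. Qed.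

Let N_closed (u : nat -> H) l (c : R) :
  u @ \oo --> l -> (forall n, N (u n) <= c%:E)%E -> (N l <= c%:E)%E.
Proof.
move=> ul Nc.
have -> : N l = (\int[mu]_w (limn_einf (fun n => (rnorm (F (u n) w))%:E)))%E.
  apply: eq_integral => w _; apply/esym.
  apply: (cvg_limn_einf_sup _).1; apply/cvg_EFin; first exact: nearW.
  by apply: cvg_rnormr; exact: cvg_F.
apply: (le_trans (fatou _ _ _ _)) => //.
- by move=> n; exact: strongly_measurable_rnorm.
- by move=> n w _; rewrite lee_fin rnorm_ge0.
rewrite limn_einf_lim; apply: lime_le; first exact: is_cvg_einfs.
apply: nearW => n; apply: le_trans (Nc n); apply: ereal_inf_lbound.
by exists n => /=.
Qed.

Let F_scale (t : R) f w : F (t%:C *: f) w = (t ^+ 2)%:C *: F f w.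
Proof.
by rewrite /F ipZl ipZr conjCE conjc_real cmulZl cmulZr scalerA -rmorphM expr2.
Qed.

Let N_scale (t : R) f : N (t%:C *: f) = ((t ^+ 2)%:E * N f)%E.
Proof.
rewrite /N; under eq_integral do rewrite F_scale rnormZr ger0_norm ?sqr_ge0// EFinM.
rewrite ge0_integralZl_EFin ?sqr_ge0//.
  by move=> w _; rewrite lee_fin rnorm_ge0.
exact: strongly_measurable_rnorm.
Qed.

(** [2 F h = F (x + h) + F (x - h) - 2 F x]. *)
Let N_parallelogram (x h : H) : (N h <= N (x + h)%R + N (x - h)%R + (N x + N x))%E.
Proof.
have m f := strongly_measurable_rnorm (F_meas f).
have r f w : (0 <= (rnorm (F f w))%:E)%E by rewrite lee_fin rnorm_ge0.
rewrite /N -!ge0_integralD//; try by move=> *; rewrite ?adde_ge0.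
- apply: ge0_le_integral => //.
    by do 2?apply: emeasurable_funD.
  move=> w _; rewrite -!EFinD lee_fin.
  have e : 2%:C *: F h w = (F (x + h) w + F (x - h) w) - (F x w + F x w).
    rewrite /F !(ipDl _ _ (X w)) !(ipDr (Y w)) ipNl ipNr.
    rewrite !cmulDl !cmulDr !(cmulNl, cmulNr) opprK.
    set P := _ ⋅ ip (Y w) x; set Q := ip x (X w) ⋅ _; set S := _ ⋅ ip (Y w) x.
    set U := _ ⋅ _.
    rewrite (addrC (- S) U) (addrACA (P + Q)) (addrACA P Q) (addrC S U).
    rewrite (addrACA U S) !subrr !addr0 [RHS]addrAC subrr add0r.
    by rewrite rmorphD/= scalerDl scale1r.
  have := rnormD (F (x + h) w + F (x - h) w) (- (F x w + F x w)).
  have := rnormD (F (x + h) w) (F (x - h) w); have := rnormD (F x w) (F x w).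
  rewrite -e rnormZr ger0_norm// rnormN.
  have := rnorm_ge0 (F h w); lra.
- exact: emeasurable_funD.
- exact: emeasurable_funD.
Qed.

(** The integral of [|F f|] is finite for every [f] and lower semicontinuous in
    [f] by Fatou's lemma, hence bounded on some ball; the parallelogram identity
    moves the ball to the origin and homogeneity extends the bound. *)
Lemma integral_rnorm_form_bound : exists2 C : R, 0 <= C &
  forall f, (N f <= (C * rnorm f ^+ 2)%:E)%E.
Proof.
have [x [r [c [r0 near_x]]]] := locally_bounded N_closed N_fin.
have Nx : (N x <= c%:E)%E by apply: near_x; rewrite subrr rnorm0.
have c0 : 0 <= c by rewrite -lee_fin (le_trans (N_ge0 x)).
have small h : rnorm h < r -> (N h <= (4 * c)%:E)%E.
  move=> hr; apply: (le_trans (N_parallelogram x h)).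
  have -> : 4 * c = c + c + (c + c) by ring.
  rewrite !EFinD !leeD//; apply: near_x.
    by rewrite addrAC subrr add0r.
  by rewrite addrAC subrr add0r rnormN.
have C0 : 0 <= 16 * c / r ^+ 2 by rewrite divr_ge0 ?sqr_ge0// mulr_ge0.
exists (16 * c / r ^+ 2) => // f.
have [->|f0] := eqVneq f 0.
  have -> : N 0 = 0%E.
    by apply: integral0_eq => w _; rewrite /F ip0l cmul0l rnorm0.
  by rewrite rnorm0 expr0n mulr0.
have fp : 0 < rnorm f by rewrite lt_neqAle eq_sym rnorm_eq0 f0 rnorm_ge0.
pose t := r / (2 * rnorm f).
have t0 : 0 < t by rewrite divr_gt0// mulr_gt0.
have tf : rnorm (t%:C *: f) < r.
  rewrite rnormZr gtr0_norm// /t invfM mulrA mulfVK ?gt_eqF//; lra.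
have := small _ tf; rewrite N_scale -lee_pdivlMl ?exprn_gt0// => /le_trans; apply.
rewrite -EFinM lee_fin le_eqVlt; apply/orP; left; apply/eqP.
rewrite /t; move: (rnorm f) fp => q q0; field.
by apply/andP; split; exact: lt0r_neq0.
Qed.

Lemma rnorm_form_bound : exists2 C : R, 0 <= C &
  forall f I, is_bochner_integral mu (F f) I -> rnorm I <= C * rnorm f ^+ 2.
Proof.
have [C C0 bound] := integral_rnorm_form_bound; exists C => // f I bI.
rewrite -lee_fin; apply: le_trans (rnorm_bochner bI) _; exact: bound.
Qed.

Lemma biframe_integrand_act a f w :
  F (act a f) w = a ⋅ F f w ⋅ cstar a.
Proof. by rewrite /F ip_act ip_actr !cmulA. Qed.

(** By [biframe_integrand_act], the bound on [|I|] holds for all [a I a^*]; this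
    is the hypothesis of [cpositive_of_form], for [I] as well as for [- I]. *)
Lemma form_two_sided : exists2 C : R, 0 <= C &
  forall f I, cstar I = I -> is_bochner_integral mu (F f) I ->
    cpositive (C%:C *: ip f f - I) /\ cpositive (C%:C *: ip f f + I).
Proof.
have [C C0 bound] := rnorm_form_bound; exists C => // f I II bI.
have aIa a : cstar a = a -> rnorm (a ⋅ I ⋅ a) <= C * rnorm (a ⋅ ip f f ⋅ a).
  move=> aa; have := bochner_conj a bI; rewrite aa => baI.
  have -> : a ⋅ ip f f ⋅ a = ip (act a f) (act a f).
    by rewrite ip_act ip_actr aa cmulA.
  rewrite rnorm_ip; apply: bound; congr is_bochner_integral : baI.
  by apply/funext => w; rewrite biframe_integrand_act aa.
split; first by apply: cpositive_of_form => //; exact: ip_ge0.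
rewrite -[I]opprK; apply: cpositive_of_form => //; first exact: ip_ge0.
  by rewrite cstarN II.
by move=> a aa; rewrite cmulNr cmulNl rnormN; exact: aIa.
Qed.

End FormBound.

(** * Tensor products *)

Section TensorAlgebra.
Context {R : realType} {A : cstarAlgebraType R} {H1 H2 H : hilbertModuleType A}.
Variable tens : H1 -> H2 -> H.
Hypothesis ip_tens : forall f1 f2 g1 g2,
  ip (tens f1 g1) (tens f2 g2) = ip f1 f2 ⋅ ip g1 g2.

(** Taking adjoints in the formula for the inner product reverses the factors,
    whereas the formula itself does not. *)
Lemma ip_comm (f1 f2 : H1) (g1 g2 : H2) : ip f1 f2 ⋅ ip g1 g2 = ip g1 g2 ⋅ ip f1 f2.
Proof.
have := cstar_ip (tens f2 g2) (tens f1 g1).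
by rewrite !ip_tens cstarM !cstar_ip.
Qed.

Let tens_eq (z : H) x y (c : A) : (forall u v, ip z (tens u v) = 0) ->
  ip z (act c (tens x y)) = 0.
Proof. by move=> z0; rewrite ip_actr z0 cmul0l. Qed.

(** The difference of both sides is orthogonal to all pure tensors, hence to
    itself; additivity of [tens] is obtained in the same way. *)
Lemma tens_act (a b : A) x y : tens (act a x) (act b y) = act (a ⋅ b) (tens x y).
Proof.
set z := tens _ _; set z' := act _ _.
have orth u v : ip (z - z') (tens u v) = 0.
  rewrite ipBl /z /z' ip_act !ip_tens !ip_act -cmulA.
  rewrite -(ip_act b) ip_comm ip_act.
  by rewrite -!cmulA -(ip_comm x u y v) subrr.
apply/eqP; rewrite -subr_eq0; apply/eqP; apply: ip_definite.
by rewrite ipBr {2}/z' tens_eq// /z orth subrr.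
Qed.

Lemma tensDl x x' y : tens (x + x') y = tens x y + tens x' y.
Proof.
apply/eqP; rewrite -subr_eq0; apply/eqP; apply: ip_definite.
set z := _ - _.
have orth u v : ip z (tens u v) = 0.
  by rewrite ipBl ipDl !ip_tens ipDl cmulDl subrr.
by rewrite {2}/z ipBr ipDr !orth addr0 subrr.
Qed.

Lemma tensDr x y y' : tens x (y + y') = tens x y + tens x y'.
Proof.
apply/eqP; rewrite -subr_eq0; apply/eqP; apply: ip_definite.
set z := _ - _.
have orth u v : ip z (tens u v) = 0.
  by rewrite ipBl ipDl !ip_tens ipDl cmulDr subrr.
by rewrite {2}/z ipBr ipDr !orth addr0 subrr.
Qed.

Let scaleE (K : hilbertModuleType A) (k : R[i]) (x : K) : k *: x = act (k *: cone) x.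
Proof. by rewrite actZ act1. Qed.

Lemma tens_bilinear : contractive_bilinear tens.
Proof.
split.
- exact: tensDl.
- exact: tensDr.
- by move=> k x y; rewrite scaleE -{1}(act1 y) tens_act cmul1r -scaleE.
- by move=> k x y; rewrite scaleE -{1}(act1 x) tens_act cmul1l -scaleE.
- move=> x y; rewrite -ler_sqr ?nnegrE ?mulr_ge0 ?rnorm_ge0//.
  by rewrite exprMn -!rnorm_ip ip_tens rnorm_cmul.
Qed.

End TensorAlgebra.

Section TensorBiframes.
Context {R : realType} {A : cstarAlgebraType R} {H1 H2 H : hilbertModuleType A}.
Context {tens : H1 -> H2 -> H}.
Hypothesis ip_tens : forall f1 f2 g1 g2,
  ip (tens f1 g1) (tens f2 g2) = ip f1 f2 ⋅ ip g1 g2.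
Context {d1 d2 : measure_display}.
Context {T1 : measurableType d1} {T2 : measurableType d2}.
Variables (mu1 : {measure set T1 -> \bar R}) (mu2 : {measure set T2 -> \bar R}).
Variable mu : {measure set (T1 * T2) -> \bar R}.
Hypothesis muP : is_product_measure mu1 mu2 mu.

(** The integral over the product is [I1 I2]. The constants bounding [I1] and [I2]
    from both sides come from [form_two_sided]; the upper bounds alone would not
    control [I1 I2], as both factors may be negative. *)
Lemma tensor_biframe_bessel (X1 Y1 : T1 -> H1) (X2 Y2 : T2 -> H2) :
  biframe_bessel mu1 X1 Y1 -> biframe_bessel mu2 X2 Y2 ->
  biframe_bessel_on (pure_tensors tens) mu
    (fun w => tens (X1 w.1) (X2 w.2)) (fun w => tens (Y1 w.1) (Y2 w.2)).
Proof.
move=> [meas1 [B1 [_ int1]]] [meas2 [B2 [_ int2]]].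
have comm := ip_comm ip_tens.
have ex1 f : exists I, is_bochner_integral mu1 (biframe_integrand X1 Y1 f) I.
  by have [I [bI _]] := int1 f Logic.I; exists I.
have ex2 f : exists I, is_bochner_integral mu2 (biframe_integrand X2 Y2 f) I.
  by have [I [bI _]] := int2 f Logic.I; exists I.
have [C1 C1ge0 two1] := form_two_sided ex1.
have [C2 C2ge0 two2] := form_two_sided ex2.
split=> [_ [f1 [f2 ->]]|].
  have [mX1 mY1] := meas1 f1 Logic.I; have [mX2 mY2] := meas2 f2 Logic.I.
  split; under eq_fun do rewrite ip_tens.
    exact: (strongly_measurable_bilin cmul_bilinear mX1 mX2).
  exact: (strongly_measurable_bilin cmul_bilinear mY1 mY2).
pose C := C1 + C2 + 1.
have C0 : 0 < C by rewrite ltr_wpDl// addr_ge0.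
exists (C ^+ 2); split; first by rewrite exprn_gt0.
move=> _ [f1 [f2 ->]].
have [I1 [b1 [I1s _ _]]] := int1 f1 Logic.I.
have [I2 [b2 [I2s _ _]]] := int2 f2 Logic.I.
(* The bounds with [C1] and [C2] hold a fortiori with the common constant [C]. *)
have raise (c : R) (p : A) : 0 <= c -> c <= C -> cpositive p ->
    exists2 r, cpositive r & C%:C *: p = c%:C *: p + r.
  move=> c0 cC pp; exists ((C - c)%:C *: p).
    by apply: cpositiveZ; rewrite ?subr_ge0.
  by rewrite -scalerDl -rmorphD/= addrC subrK.
have C1C : C1 <= C by rewrite /C; lra.
have C2C : C2 <= C by rewrite /C; lra.
have [r1 r1pos r1E] := raise C1 (ip f1 f1) C1ge0 C1C (ip_ge0 f1).
have [r2 r2pos r2E] := raise C2 (ip f2 f2) C2ge0 C2C (ip_ge0 f2).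
have [lo1 up1] := two1 f1 I1 I1s b1; have [lo2 up2] := two2 f2 I2 I2s b2.
have I1comm (g g' : H2) : I1 ⋅ ip g g' = ip g g' ⋅ I1.
  apply: bochner_comm b1 => w.
  by rewrite -cmulA comm cmulA comm -cmulA.
have I2comm (g g' : H1) : I2 ⋅ ip g g' = ip g g' ⋅ I2.
  apply: bochner_comm b2 => w.
  by rewrite -cmulA -comm cmulA -comm -cmulA.
have I12 : I1 ⋅ I2 = I2 ⋅ I1.
  apply/esym; apply: bochner_comm b2 => w.
  by rewrite -cmulA -I1comm cmulA -I1comm -cmulA.
exists (I1 ⋅ I2); split.
  have -> : (fun w : T1 * T2 =>
      ip (tens f1 f2) (tens (X1 w.1) (X2 w.2)) ⋅
      ip (tens (Y1 w.1) (Y2 w.2)) (tens f1 f2)) =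
    (fun w => biframe_integrand X1 Y1 f1 w.1 ⋅ biframe_integrand X2 Y2 f2 w.2).
    apply/funext => w; rewrite !ip_tens /biframe_integrand.
    by rewrite -!cmulA; congr (_ ⋅ _); rewrite !cmulA comm.
  exact: (bochner_bilin muP cmul_bilinear b1 b2).
split.
- exact: cstar_mul_comm.
- by rewrite cstarZr cstar_ip.
rewrite ip_tens; apply: cpositive_mul_bounds => //.
- by rewrite r1E addrAC; exact: cpositiveD.
- by rewrite r1E addrAC; exact: cpositiveD.
- by rewrite r2E addrAC; exact: cpositiveD.
- by rewrite r2E addrAC; exact: cpositiveD.
Qed.

Lemma tensor_multiplier_integral (X1 Y1 : T1 -> H1) (X2 Y2 : T2 -> H2)
    (m1 : T1 -> R[i]) (m2 : T2 -> R[i]) (M1 : H1 -> H1) (M2 : H2 -> H2) f g :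
  is_multiplier mu1 m1 X1 Y1 M1 -> is_multiplier mu2 m2 X2 Y2 M2 ->
  is_bochner_integral mu
    (fun w => (m1 w.1 * m2 w.2) *:
       act (ip (tens f g) (tens (X1 w.1) (X2 w.2))) (tens (Y1 w.1) (Y2 w.2)))
    (tens (M1 f) (M2 g)).
Proof.
move=> [_ _ b1] [_ _ b2]; have tensP := tens_bilinear ip_tens.
have := bochner_bilin muP tensP (b1 f Logic.I) (b2 g Logic.I).
congr is_bochner_integral; apply/funext => w.
by rewrite ip_tens -(tens_act ip_tens) (bilinZl tensP) (bilinZr tensP) scalerA.
Qed.

End TensorBiframes.

Theorem proposition6p3 (R : realType) (A : cstarAlgebraType R)
    (H1 H2 H : hilbertModuleType A) (tens : H1 -> H2 -> H)
    (tensP : is_tensor_product tens)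
    (d1 d2 : measure_display)
    (Omega1 : measurableType d1) (Omega2 : measurableType d2)
    (mu1 : {measure set Omega1 -> \bar R})
    (mu2 : {measure set Omega2 -> \bar R})
    (mu : {measure set (Omega1 * Omega2) -> \bar R})
    (muP : is_product_measure mu1 mu2 mu)
    (X1 Y1 : Omega1 -> H1) (X2 Y2 : Omega2 -> H2)
    (bessel1 : biframe_bessel mu1 X1 Y1)
    (bessel2 : biframe_bessel mu2 X2 Y2)
    (m1 : Omega1 -> R[i]) (m2 : Omega2 -> R[i])
    (m1_meas : complex_measurable m1) (m2_meas : complex_measurable m2) :
  let X := fun w : Omega1 * Omega2 => tens (X1 w.1) (X2 w.2) in
  let Y := fun w : Omega1 * Omega2 => tens (Y1 w.1) (Y2 w.2) in
  let m := fun w : Omega1 * Omega2 => m1 w.1 * m2 w.2 in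
  biframe_bessel_on (pure_tensors tens) mu X Y /\
  forall (M1 : H1 -> H1) (M2 : H2 -> H2),
    is_multiplier mu1 m1 X1 Y1 M1 ->
    is_multiplier mu2 m2 X2 Y2 M2 ->
    forall M : H -> H,
      is_multiplier_on (pure_tensors tens) mu m X Y M <->
      is_tensor_operator tens M1 M2 M.
Proof.
have [ip_tens _] := tensP.
move=> X Y m; split; first exact: (tensor_biframe_bessel ip_tens muP).
move=> M1 M2 mult1 mult2 M.
have int f g := tensor_multiplier_integral ip_tens muP f g mult1 mult2.
split=> [[linM contM intM]|[linM contM MT]]; split=> //.
  move=> f g; apply: bochner_unique (int f g).
  by apply: intM; exists f, g.
by move=> _ [f [g ->]]; rewrite MT; exact: int.
Qed.
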